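(* Let $N \geqslant 1$, let $\Omega \subseteq \mathbb{R}^N$ be an open set and let $1 \leqslant p < \infty$. The following inequalities hold. (i) There exists a constant $C_{p,N} > 0$, depending only on $p$ and $N$, such that $$\int_{\Omega} |u(x)|^p \, dx \leqslant C_{p,N}^p \int_{\Omega} |x|^p \, |\nabla_{\mathrm{sym}} u(x)|^p \, dx \qquad \text{for all } u \in C^{\infty}_c(\Omega, \mathbb{R}^N).$$ In particular, if $\Omega$ is also bounded, then there exists a constant $\kappa_{p,\Omega} > 0$, depending only on $p$ and $\Omega$, such that $$\int_{\Omega} |u|^p \, dx \leqslant \kappa_{p,\Omega}^p \int_{\Omega} |\nabla_{\mathrm{sym}} u|^p \, dx \qquad \text{for all } u \in C^{\infty}_c(\Omega, \mathbb{R}^N).$$ (ii) If $\Omega$ is a bounded Lipschitz domain, then there exist constants $\kappa_{p,\Omega}, \kappa_{p,\partial\Omega} > 0$, depending only on $p$ and $\Omega$, such that $$\int_{\Omega} |u|^p \, dx \leqslant \kappa_{p,\Omega}^p \int_{\Omega} |\nabla_{\mathrm{sym}} u|^p \, dx + \kappa_{p,\partial\Omega} \int_{\partial\Omega} |u|^p \, dS \qquad \text{for all } u \in C^{\infty}(\overline{\Omega}, \mathbb{R}^N),$$ where $dS$ denotes surface measure on $\partial\Omega$.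
   Context: For a vector $v \in \mathbb{R}^N$, $|v|$ is the Euclidean norm; for a matrix $\Phi \in \mathbb{R}^{N\times N}$, $|\Phi| = \big(\sum_{i,j=1}^N (\Phi e_i \cdot e_j)^2\big)^{1/2}$ is the Frobenius norm, and $|\cdot|^p$ is the $p$-th power of these norms. For a vector field $u$, $\nabla u$ is the $N \times N$ matrix whose columns are the gradients of the components of $u$, $\nabla^{\mathsf T} u$ is its transpose (the Jacobian matrix), and $\nabla_{\mathrm{sym}} u := \frac12(\nabla u + \nabla^{\mathsf T} u)$ is the symmetric gradient. $C^\infty_c(\Omega, \mathbb{R}^N)$ is the space of infinitely differentiable vector fields with compact support in $\Omega$, and $C^\infty(\overline\Omega, \mathbb{R}^N)$ is the space of infinitely differentiable vector fields that are smooth up to the boundary. *)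

(* Defs.v *)
From HB Require Import structures.
From mathcomp Require Import all_boot all_order all_algebra.
From mathcomp Require Import all_classical all_reals all_analysis.

Set Implicit Arguments.
Unset Strict Implicit.
Unset Printing Implicit Defensive.

Import Order.TTheory GRing.Theory Num.Theory.
Import numFieldNormedType.Exports.

Local Open Scope classical_set_scope.
Local Open Scope ring_scope.

(* R^n is 'rV[R]_n.  The library's norm and topology on it are those of the
   sup norm; the topology is the Euclidean one, but the norm is not. *)

(* Frobenius norm; on 'rV[R]_n it is the Euclidean norm. *)
Definition frobenius {R : realType} {m n : nat} (A : 'M[R]_(m, n)) : R :=
  Num.sqrt (\sum_(i < m) \sum_(j < n) A i j ^+ 2).

Section derivatives.
Context {R : realType} {n : nat}.
Implicit Types (f : 'rV[R]_n -> R) (u : 'rV[R]_n -> 'rV[R]_n).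
Implicit Types D Omega : set 'rV[R]_n.

Definition partial (i : 'I_n) f : 'rV[R]_n -> R :=
  'D_(delta_mx 0 i) f.

Definition partials (s : seq 'I_n) f : 'rV[R]_n -> R := foldr partial f s.

(* The columns are the gradients of the components of u. *)
Definition gradient u (x : 'rV[R]_n) : 'M[R]_n :=
  \matrix_(i, j) partial i (fun y => u y 0 j) x.

Definition sym_gradient u (x : 'rV[R]_n) : 'M[R]_n :=
  2^-1 *: (gradient u x + (gradient u x)^T).

(* For D open: f is of class C^oo on D. *)
Definition smooth_on D f : Prop :=
  forall s : seq 'I_n, forall x, D x ->
    {for x, continuous (partials s f)} /\
    forall i, derivable (partials s f) x (delta_mx 0 i).

(* Elements of C_c^oo(Omega, R^n) are identified with their extensions by
   zero to R^n. *)
Definition smooth_compactly_supported Omega u : Prop :=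
  [/\ forall j, smooth_on setT (fun x => u x 0 j),
      compact (closure [set x | u x != 0]) &
      closure [set x | u x != 0] `<=` Omega].

(* C^oo(closure of Omega, R^n): smooth in Omega, continuous on the closure, and
   every partial derivative extends continuously to the closure.  The values
   of u outside the closure are irrelevant. *)
Definition smooth_up_to_boundary Omega u : Prop :=
  [/\ forall j, smooth_on Omega (fun x => u x 0 j),
      {within closure Omega, continuous u} &
      forall (s : seq 'I_n) j, exists2 g : 'rV[R]_n -> R,
        {within closure Omega, continuous g} &
        forall x, Omega x -> g x = partials s (fun y => u y 0 j) x].

Definition boundary Omega : set 'rV[R]_n := closure Omega `\` interior Omega.

(* Near each boundary point, in the orthonormal coordinates x *m Q, Omega is
   the strict epigraph of a Lipschitz function of the coordinates other than
   the i-th one. *)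
Definition lipschitz_boundary Omega : Prop :=
  forall x0, boundary Omega x0 ->
    exists r : R, exists Q : 'M[R]_n, exists i : 'I_n,
    exists gamma : 'rV[R]_n.-1 -> R,
      [/\ 0 < r, Q *m Q^T = 1%:M, lipschitz gamma &
        forall x, frobenius (x - x0) < r ->
          (Omega x <-> gamma (col' i (x *m Q)) < (x *m Q) 0 i)].

Definition bounded_lipschitz_domain Omega : Prop :=
  [/\ open Omega, bounded_set Omega & lipschitz_boundary Omega].

End derivatives.

(* The product sigma-algebra on 'rV[R]_n, which is also the Borel
   sigma-algebra; this is the library's definition for n.-tuple. *)
Section measurable_rV.
Context {R : realType} {n : nat}.

Let coors : 'I_n -> 'rV[R]_n -> R := fun i x => x ord0 i.

Let rV_set0 : g_sigma_preimage coors set0.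
Proof. exact: sigma_algebra0. Qed.

Let rV_setC A : g_sigma_preimage coors A -> g_sigma_preimage coors (~` A).
Proof. exact: sigma_algebraC. Qed.

Let rV_bigcup (F : _^nat) : (forall i, g_sigma_preimage coors (F i)) ->
  g_sigma_preimage coors (\bigcup_i (F i)).
Proof. exact: sigma_algebra_bigcup. Qed.

HB.instance Definition _ := @isMeasurable.Build
  (measure_tuple_display default_measure_display)
  'rV[R]_n (g_sigma_preimage coors) rV_set0 rV_setC rV_bigcup.

End measurable_rV.

Lemma measurable_coord {R : realType} {n : nat} (i : 'I_n) :
  measurable_fun setT (fun x : 'rV[R]_n => x ord0 i).
Proof.
move=> _ Y mY; rewrite setTI; apply: sub_sigma_algebra => /=.
rewrite -bigcup_seq/=; exists i => /=; first by rewrite mem_index_enum.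
by exists Y => //; rewrite setTI.
Qed.

Lemma measurable_fun_rVP d {R : realType} {n : nat} (T : measurableType d)
    (f : T -> 'rV[R]_n) :
  (forall i, measurable_fun setT (fun x => f x ord0 i)) -> measurable_fun setT f.
Proof.
move=> mf; apply: measurability => [//|] _ [B + <-].
rewrite -bigcup_seq/= => -[i _] [C mC <-].
have := mf i measurableT C mC; rewrite !setTI.
by [].
Qed.

Definition rV_cons {R : realType} {n : nat}
  (p : measurableTypeR R * 'rV[R]_n) : 'rV[R]_n.+1 :=
  row_mx (const_mx p.1 : 'rV_1) p.2.

Definition rV_uncons {R : realType} {n : nat} (x : 'rV[R]_n.+1) :
  measurableTypeR R * 'rV[R]_n := (x ord0 ord0, \row_i x ord0 (lift ord0 i)).

Lemma rV_consK {R : realType} {n : nat} :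
  cancel (@rV_cons R n) (@rV_uncons R n).
Proof.
move=> [t y]; rewrite /rV_cons /rV_uncons/=; congr pair.
  have -> : ord0 = lshift n (ord0 : 'I_1) :> 'I_(1 + n) by exact/val_inj.
  exact: etrans (row_mxEl _ _ _ _) (mxE _ _ _ _).
apply/rowP => i; rewrite mxE.
have -> : lift ord0 i = rshift 1 i :> 'I_(1 + n) by exact/val_inj.
exact: row_mxEr.
Qed.

Lemma measurable_rV_cons {R : realType} {n : nat} :
  measurable_fun setT (@rV_cons R n).
Proof.
apply: measurable_fun_rVP => i; case: (@split_ordP 1 n i) => j ->.
  rewrite (_ : (fun x => _) = fst); first exact: measurable_fst.
  by apply/funext => p; exact: etrans (row_mxEl _ _ _ _) (mxE _ _ _ _).
rewrite (_ : (fun x => _) = (fun y : 'rV[R]_n => y ord0 j) \o snd).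
  exact: measurableT_comp (measurable_coord j) measurable_snd.
by apply/funext => p; exact: row_mxEr.
Qed.

Lemma measurable_rV_uncons {R : realType} {n : nat} :
  measurable_fun setT (@rV_uncons R n).
Proof.
apply/measurable_fun_pairP; split => /=.
  exact: measurable_coord.
apply: measurable_fun_rVP => i.
rewrite (_ : (fun x => _) = fun x : 'rV[R]_n.+1 => x ord0 (lift ord0 i)).
  exact: measurable_coord.
by apply/funext => x /=; rewrite mxE.
Qed.

(* n-dimensional Lebesgue measure, as an iterated product measure. *)
Fixpoint lebesgue_rV {R : realType} (n : nat) : set 'rV[R]_n -> \bar R :=
  if n is n'.+1 then
    pushforward (lebesgue_measure \x @lebesgue_rV R n')%E rV_cons
  else \d_(0 : 'rV[R]_0).
Arguments lebesgue_rV {R} n.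

Section lebesgue_rV_measure.
Context {R : realType}.
Local Open Scope ereal_scope.

Let lebesgue_rV_sigma_finite_measure n :
  exists mu : {sigma_finite_measure set 'rV[R]_n -> \bar R},
    lebesgue_rV n = mu.
Proof.
elim: n => [|n [mu IH]]; first by exists (\d_(0%R : 'rV[R]_0)).
pose pm : {measure set (measurableTypeR R * 'rV[R]_n)%type -> \bar R} :=
  (lebesgue_measure \x mu).
pose m : set 'rV[R]_n.+1 -> \bar R := pushforward pm rV_cons.
have m0 : m set0 = 0 by rewrite /m /pushforward preimage_set0 measure0.
have mge0 A : 0 <= m A by exact: (measure_ge0 pm).
have msa : semi_sigma_additive m.
  move=> F mF tF mUF; rewrite /m /pushforward preimage_bigcup.
  apply: measure_semi_sigma_additive.
  - by move=> k; rewrite -[X in measurable X]setTI; exact: measurable_rV_cons.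
  - apply/trivIsetP => /= i j _ _ ij; rewrite -preimage_setI.
    by move/trivIsetP : tF => /(_ _ _ _ _ ij) ->//; rewrite preimage_set0.
  - rewrite -preimage_bigcup -[X in measurable X]setTI.
    exact: measurable_rV_cons.
have msf : sigma_finite setT m.
  have [F UF mF] : sigma_finite setT pm.
    have /sigma_finiteP[F [UF ndF mF]] := sigma_finiteT (@lebesgue_measure R).
    have /sigma_finiteP[G [UG ndG mG]] := sigma_finiteT mu.
    exists (fun k => F k `*` G k).
      rewrite -setXTT UF UG predeqE => -[x y]; split.
        move=> [/= [i _ Fix] [j _ Gjy]]; exists (maxn i j) => //; split.
        - by move: x Fix; exact/subsetPset/ndF/leq_maxl.
        - by move: y Gjy; exact/subsetPset/ndG/leq_maxr.
      by move=> [i _ []/= ? ?]; split; exists i.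
    move=> k; have [? ?] := mF k; have [? ?] := mG k.
    split; first exact: measurableX.
    have -> : pm (F k `*` G k) = lebesgue_measure (F k) * mu (G k).
      exact: product_measure1E.
    by rewrite lte_mul_pinfty// ge0_fin_numE.
  exists (fun k => rV_uncons @^-1` F k).
    by rewrite -preimage_bigcup -UF preimage_setT.
  move=> k; have [mFk Fkoo] := mF k; split.
    by rewrite -[X in measurable X]setTI; exact: measurable_rV_uncons.
  rewrite /m /pushforward (_ : _ @^-1` _ = F k)//.
  by apply/seteqP; split => p /=; rewrite rV_consK.
pose M1 := isMeasure.Build _ _ _ m m0 mge0 msa.
pose M : {measure set 'rV[R]_n.+1 -> \bar R} := HB.pack m M1.
pose S1 := Measure_isSigmaFinite.Build _ _ _ M msf.
pose S : {sigma_finite_measure set 'rV[R]_n.+1 -> \bar R} := HB.pack m M1 S1.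
by exists S => /=; rewrite IH.
Qed.

Variable n : nat.

Let lebesgue_rV0 : lebesgue_rV n (set0 : set 'rV[R]_n) = 0.
Proof. by have [mu ->] := lebesgue_rV_sigma_finite_measure n. Qed.

Let lebesgue_rV_ge0 (A : set 'rV[R]_n) : 0 <= lebesgue_rV n A.
Proof. by have [mu ->] := lebesgue_rV_sigma_finite_measure n. Qed.

Let lebesgue_rV_sigma_additive : semi_sigma_additive (@lebesgue_rV R n).
Proof.
have [mu ->] := lebesgue_rV_sigma_finite_measure n.
exact: measure_semi_sigma_additive.
Qed.

HB.instance Definition _ := isMeasure.Build _ _ _ (@lebesgue_rV R n)
  lebesgue_rV0 lebesgue_rV_ge0 lebesgue_rV_sigma_additive.

Let lebesgue_rV_sigma_finite : sigma_finite setT (@lebesgue_rV R n).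
Proof.
have [mu ->] := lebesgue_rV_sigma_finite_measure n.
exact: sigma_finiteT.
Qed.

HB.instance Definition _ := Measure_isSigmaFinite.Build _ _ _ (@lebesgue_rV R n)
  lebesgue_rV_sigma_finite.

End lebesgue_rV_measure.

(* Caratheodory's construction from a family C of admissible covering sets and
   a gauge w. *)
Definition cover_outer {R : realType} {T : Type} (C : set (set T))
    (w : set T -> \bar R) (A : set T) : \bar R :=
  ereal_inf [set (\sum_(k <oo) w (F k))%E | F in
    [set F : nat -> set T | (forall k, C (F k)) /\ A `<=` \bigcup_k F k]].

Section cover_outer_theory.
Context {R : realType} {T : Type}.
Variables (C : set (set T)) (w : set T -> \bar R).
Hypotheses (C0 : C set0) (w0 : w set0 = 0%E) (w_ge0 : forall A, (0 <= w A)%E).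
Local Open Scope ereal_scope.
Local Notation mu := (cover_outer C w).

Lemma le_cover_outer : {homo mu : A B / A `<=` B >-> A <= B}.
Proof.
move=> A B AB; apply/ereal_inf_le_tmp => x [F [CF BF]].
by move=> <-{x}; exists F => //; split => //; exact: subset_trans AB BF.
Qed.

Lemma cover_outer_ge0 A : 0 <= mu A.
Proof.
by apply: le_ereal_inf_tmp => x [F [CF AF] <-{x}]; exact: nneseries_ge0.
Qed.

Lemma cover_outer0 : mu set0 = 0.
Proof.
apply/eqP; rewrite eq_le cover_outer_ge0 andbT.
apply: ereal_inf_lbound; exists (fun=> set0); first by split.
by rewrite eseries0.
Qed.

Lemma cover_outer_sigma_subadditive : sigma_subadditive mu.
Proof.
move=> A; have [[i ioo]|] := pselect (exists i, mu (A i) = +oo).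
  rewrite (eseries_pinfty _ _ ioo) ?leey// => n _.
  by rewrite -ltNye (lt_le_trans _ (cover_outer_ge0 _)).
rewrite -forallNE => Aoo.
suff add2e (e : {posnum R}) :
    mu (\bigcup_n A n) <= \sum_(i <oo) mu (A i) + e%:num%:E.
  by apply/lee_addgt0Pr => _/posnumP[].
rewrite (le_trans _ (epsilon_trick _ _ _))//; last first.
  by move=> n; exact: cover_outer_ge0.
pose P n (B : (set T)^nat) := ((forall k, C (B k)) /\ A n `<=` \bigcup_k B k) /\
  \sum_(k <oo) w (B k) <= mu (A n) + (e%:num / (2 ^ n.+1)%:R)%:E.
have [G PG] : {G : ((set T)^nat)^nat & forall n, P n (G n)}.
  apply: (@choice _ _ P) => n; rewrite /P /cover_outer.
  set S := (X in ereal_inf X); move infS : (ereal_inf S) => iS.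
  case: iS infS => [r Sr|Soo|Soo].
  - have en1 : (0 < e%:num / (2 ^ n.+1)%:R)%R by [].
    have /(lb_ereal_inf_adherent en1) : ereal_inf S \is a fin_num by rewrite Sr.
    move=> [x [B [mB AnB] muBx] xS].
    by exists B; split => //; rewrite muBx -Sr; exact/ltW.
  - by have := Aoo n; rewrite /cover_outer Soo.
  - suff : lbound S 0 by move/le_ereal_inf_tmp; rewrite Soo.
    by move=> /= _ [B [mB AnB] <-]; exact: nneseries_ge0.
have wG_ge0 x : 0 <= (w \o uncurry G) x by exact: w_ge0.
apply: (@le_trans _ _ (\esum_(i in setT) (w \o uncurry G) i)).
  rewrite /cover_outer; apply: ereal_inf_lbound => /=.
  have /card_esym/ppcard_eqP[f] := card_nat2.
  exists (uncurry G \o f).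
    split => [i|]; first by rewrite /= /uncurry; case: (f i) => a b; exact: (PG a).1.1.
    apply: (@subset_trans _  (\bigcup_n \bigcup_k G n k)) => [t [i _]|].
      by move=> /((PG i).1.2) -[j _ ?]; exists i => //; exists j.
    move=> t [i _ [j _ Bijt]]; exists (f^-1%FUN (i, j)) => //=.
    by rewrite invK ?inE.
  rewrite -(esum_pred_image (w \o uncurry G) _ xpredT) ?[fun=> _]set_true//.
  by rewrite image_eq.
rewrite (_ : esum _ _ = \sum_(i <oo) \sum_(j <oo) w (G i j)); last first.
  pose J : nat -> set (nat * nat) := fun i => [set (i, j) | j in setT].
  rewrite (_ : setT = \bigcup_k J k); last first.
    by rewrite predeqE => -[a b]; split => // _; exists a => //; exists b.
  rewrite esum_bigcupT /=; last 2 first.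
    - apply/trivIsetP => i j _ _ ij.
      rewrite predeqE => -[n m] /=; split => //= -[] [_] _ [<-{n} _].
      by move=> [m' _] [] /esym/eqP; rewrite (negbTE ij).
    - by [].
  rewrite -(image_id [set: nat]) -fun_true esum_pred_image//; last first.
    by move=> n _; exact: esum_ge0.
  apply: eq_eseriesr => /= j _.
  rewrite -(esum_pred_image (w \o uncurry G) (pair j) predT)//=; last first.
    by move=> ? ? _ _; exact: (@can_inj _ _ _ snd).
  by congr esum; rewrite predeqE => -[a b]; split; move=> [i _ <-]; exists i.
apply: lee_nneseries => [n _ _|n _]; first exact: nneseries_ge0.
exact: (PG n).2.
Qed.

End cover_outer_theory.

Section hausdorff.
Context {R : realType} {n : nat}.
Implicit Types A : set 'rV[R]_n.
Local Open Scope ereal_scope.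

(* Euclidean diameter; -oo for the empty set. *)
Definition ediam A : \bar R :=
  ereal_sup [set (frobenius (p.1 - p.2))%:E | p in A `*` A].

Definition unit_ball_volume (s : nat) : \bar R :=
  lebesgue_rV s [set x : 'rV[R]_s | (frobenius x < 1)%R].

(* For s = 0 every nonempty set, singletons included, has gauge 1. *)
Definition hausdorff_gauge (s : nat) A : \bar R :=
  if A == set0 then 0 else unit_ball_volume s * (ediam A * 2^-1%:E) ^+ s.

Definition hausdorff_delta (s : nat) (delta : R) : set 'rV[R]_n -> \bar R :=
  cover_outer [set A | ediam A <= delta%:E] (hausdorff_gauge s).

(* s-dimensional Hausdorff (outer) measure, normalized so as to agree with
   s-dimensional surface measure on s-dimensional submanifolds. *)
Definition hausdorff (s : nat) A : \bar R :=
  ereal_sup [set hausdorff_delta s delta A | delta in [set delta : R | (0 < delta)%R]].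

Lemma hausdorff_gauge_ge0 s A : 0 <= hausdorff_gauge s A.
Proof.
rewrite /hausdorff_gauge; case: ifPn => // /set0P[x Ax].
rewrite mule_ge0// expe_ge0// mule_ge0//.
apply: le_trans (_ : (frobenius (x - x))%:E <= _).
  by rewrite lee_fin sqrtr_ge0.
by apply: ereal_sup_ubound; exists (x, x).
Qed.

Let ediam0_le (delta : R) : ediam set0 <= delta%:E.
Proof. by rewrite /ediam setX0 image_set0 ereal_sup0 leNye. Qed.

Let hausdorff_gauge0 s : hausdorff_gauge s set0 = 0.
Proof. by rewrite /hausdorff_gauge eqxx. Qed.

Let hd_ge0 s delta A : 0 <= hausdorff_delta s delta A.
Proof. by apply: cover_outer_ge0 => B; exact: hausdorff_gauge_ge0. Qed.

Variable s : nat.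

Let hausdorff0 : hausdorff s set0 = 0.
Proof.
apply/eqP; rewrite eq_le; apply/andP; split.
  apply: ge_ereal_sup => _ [delta _ <-]; rewrite /hausdorff_delta cover_outer0//.
  - exact: ediam0_le.
  - exact: hausdorff_gauge_ge0.
by apply: le_trans (hd_ge0 s 1 _) _; apply: ereal_sup_ubound; exists 1%R => /=.
Qed.

Let hausdorff_ge0 A : 0 <= hausdorff s A.
Proof.
by apply: le_trans (hd_ge0 s 1 A) _; apply: ereal_sup_ubound; exists 1%R => /=.
Qed.

Let le_hausdorff : {homo hausdorff s : A B / A `<=` B >-> A <= B}.
Proof.
move=> A B AB; apply: ge_ereal_sup => _ [delta d0 <-].
apply: le_trans (@le_cover_outer _ _ _ _ A B AB) _.
by apply: ereal_sup_ubound; exists delta.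
Qed.

Let hausdorff_sigma_subadditive : sigma_subadditive (hausdorff s).
Proof.
move=> F; apply: ge_ereal_sup => _ [delta d0 <-].
apply: le_trans (cover_outer_sigma_subadditive _ (@hausdorff_gauge_ge0 s) F) _.
apply: lee_nneseries => [k _ _|k _]; first exact: hd_ge0.
by apply: ereal_sup_ubound; exists delta.
Qed.

HB.instance Definition _ := isOuterMeasure.Build R 'rV[R]_n (hausdorff s)
  hausdorff0 hausdorff_ge0 le_hausdorff hausdorff_sigma_subadditive.

End hausdorff.

(* A packed version of the library's Caratheodory measure: for T := 'rV[R]_n,
   caratheodory_type mu could unfold to 'rV[R]_n and be given the product
   sigma-algebra. *)
Section caratheodory.
Context {R : realType} {T : pointedType}.
Variable mu : {outer_measure set T -> \bar R}.

Definition caratheodory_space : measurableType mu.-cara := caratheodory_type mu.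

Definition caratheodory_measure : {measure set caratheodory_space -> \bar R} :=
  [the measure _ _ of (mu : set (caratheodory_type mu) -> \bar R)].

End caratheodory.

Definition hausdorff_outer {R : realType} {n : nat} (s : nat) :
    {outer_measure set 'rV[R]_n -> \bar R} :=
  [the outer_measure _ _ of @hausdorff R n s].

(* (n-1)-dimensional Hausdorff measure, on its Caratheodory sigma-algebra
   (which contains the Borel sets); on a Lipschitz boundary it is dS. *)
Definition surface_measure {R : realType} (n : nat) :
    {measure set (caratheodory_space (@hausdorff_outer R n n.-1)) -> \bar R} :=
  caratheodory_measure (hausdorff_outer n.-1).

(* Main.v *)
Require Import Defs.
From HB Require Import structures.
From mathcomp Require Import all_boot all_order all_algebra.
From mathcomp Require Import all_classical all_reals all_analysis.
From mathcomp Require Import measurable_realfun ring lra.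
Import Order.TTheory GRing.Theory Num.Theory.
Import numFieldNormedType.Exports.
Local Open Scope classical_set_scope.
Local Open Scope ring_scope.

Set Implicit Arguments.
Unset Strict Implicit.
Unset Printing Implicit Defensive.

(** The diagonal entry [e_ii] of the symmetric gradient [e] of [u] is the
    derivative of the component [u_i] along the [i]-th axis. Hence each
    component is controlled by [e] along the lines parallel to its own axis,
    and both inequalities reduce to estimates for one scalar function
    [f = u_i] with derivative [D_i f]; summing over [i] only costs powers of
    [N] ([integral_frobenius_le]).

    Compact support. Let [A_s] multiply the [i]-th coordinate by [s]. The
    difference of [f x] and [f (A_K x)] is the integral over [s] in [[1, K]] of
    [x_i * D_i f (A_s x)]. By Jensen ([increment_powR]), Tonelli and the change
    of variables [A_s] ([integral_coord_affine_family]) it has a [p]-th power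
    of integral at most a constant times that of [x_i * D_i f]. By convexity
    this bounds the integral of [|f|^p] up to the term
    [2^(p - 1) * int |f (A_K x)|^p = 2^(p - 1) / K * int |f|^p]. For [K = 2^p]
    this is half of the left-hand side, which is finite, so it is absorbed
    ([hardy_coordinate]). On a bounded set the weight [|x|^p] is bounded.

    Up to the boundary. Move from [x] in [Omega] against the [i]-th axis until
    the first exit from [Omega], at the point [b x] of the boundary. The
    fundamental theorem of calculus on that segment bounds [|f x|^p] by
    [|f (b x)|^p] and the integral of [|D_i f|^p] along the segment
    ([exit_increment]); the latter integrates by translation invariance. For
    the former, the image under [b] of Lebesgue measure on [Omega] is at most a
    constant times surface measure ([exit_integral_le]): the points that exit
    in a set of diameter [d] lie in a box with one side of fixed length and
    [N - 1] sides [2 * d], whose volume is proportional to [d^(N - 1)], that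
    is, to the gauge defining Hausdorff measure ([cylinder_le_gauge]). Surface
    integrals live on the Caratheodory sigma-algebra; it contains the closed
    sets because Hausdorff measure is additive on sets at positive distance
    ([hausdorff_metric], [closed_caratheodory]). *)

(** * Row vectors: norms, Borel sets, boxes *)

Lemma rV_coord_le_norm {R : realType} {n : nat} (x : 'rV[R]_n) (i : 'I_n) :
  `|x 0 i| <= `|x|.
Proof.
rewrite [leRHS]/Num.norm /= mx_normrE.
by apply/bigmax_geP; right; exists (0, i).
Qed.

Lemma rV_norm_lt {R : realType} {n : nat} (x : 'rV[R]_n) (e : R) : 0 < e ->
  (`|x| < e) <-> (forall i, `|x 0 i| < e).
Proof.
move=> e0; split=> [xe i|xe]; first exact: le_lt_trans (rV_coord_le_norm x i) xe.
rewrite /Num.norm /= mx_normrE; apply/bigmax_ltP; split => // -[i j] _ /=.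
by rewrite ord1.
Qed.

Lemma measurable_rV_coords {R : realType} {n : nat}
    (P : 'I_n -> set (measurableTypeR R)) : (forall i, measurable (P i)) ->
  measurable [set x : 'rV[R]_n | forall i, P i (x 0 i)].
Proof.
move=> mP; rewrite (_ : mkset _ = \bigcap_(i in [set: 'I_n])
    (fun x : 'rV[R]_n => x 0 i) @^-1` P i); last first.
  by apply/seteqP; split => [x xq i _|x xq i]; [exact: xq|exact: (xq i I)].
apply: fin_bigcap_measurable => // i _.
by rewrite -[X in measurable X]setTI; apply: measurable_coord => //; exact: mP.
Qed.

(** The rational cubes form a countable basis of the topology. *)
Lemma open_measurable_rV {R : realType} {n : nat} (U : set 'rV[R]_n) :
  open U -> measurable U.
Proof.
move=> oU.
pose cube (q : 'rV[rat]_n * nat) : set 'rV[R]_n :=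
  [set x | forall i, `|x 0 i - ratr (q.1 0 i)| < q.2.+1%:R^-1].
have mcube q : measurable (cube q).
  apply: (@measurable_rV_coords _ _
    (fun i => [set t | `|t - ratr (q.1 0 i)| < q.2.+1%:R^-1])) => i.
  apply: open_measurable.
  rewrite (_ : mkset _ = ball (ratr (q.1 0 i) : R) q.2.+1%:R^-1); last first.
    by apply/seteqP; split => t /=; rewrite /ball /= distrC.
  exact: ball_open.
rewrite (_ : U = \bigcup_(q in [set: 'rV[rat]_n * nat])
    (if pselect (cube q `<=` U) then cube q else set0)); last first.
  apply/seteqP; split => [x Ux|x [q _]]; last first.
    by case: pselect => // qU; exact: qU.
  have /nbhs_ballP[e /= e0 eU] := open_nbhs_nbhs (conj oU Ux).
  have [k ke] : exists k, 2 * k.+1%:R^-1 < e.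
    have [k ke] : exists k, k.+1%:R^-1 < e / 2.
      have := near_infty_natSinv_lt (PosNum (divr_gt0 e0 (ltr0n R 2))).
      by move=> [k _ /(_ k)/= h]; exists k; apply: h => /=.
    by exists k; rewrite mulrC -ltr_pdivlMr.
  have qex i : exists q : rat, `|x 0 i - ratr q| < k.+1%:R^-1.
    have := @dense_rat R (ball (x 0 i) k.+1%:R^-1).
    case.
    - by exists (x 0 i); apply: ballxx; rewrite invr_gt0.
    - exact: ball_open.
    - by move=> y [+ [q _ qy]]; rewrite -qy => h; exists q.
  have [q hq] := choice qex.
  exists (\row_i q i, k) => //.
  have xq : cube (\row_i q i, k) x by move=> i /=; rewrite mxE.
  case: pselect => // -[] y yq; apply: eU.
  rewrite -ball_normE /=; apply: lt_trans ke.
  apply/rV_norm_lt => [|i]; first by rewrite mulr_gt0// invr_gt0.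
  rewrite !mxE mulrDl !mul1r.
  have := yq i; have := xq i => /= hx hy.
  rewrite (_ : x 0 i - y 0 i = (x 0 i - ratr ((\row_j q j) 0 i)) -
    (y 0 i - ratr ((\row_j q j) 0 i))); last by ring.
  by apply: le_lt_trans (ler_normB _ _) _; exact: ltrD.
apply: countable_bigcupT_measurable => [|q]; first exact: countableP.
by case: (pselect (cube q `<=` U)) => ?; [exact: mcube|exact: measurable0].
Qed.

Lemma closed_measurable_rV {R : realType} {n : nat} (U : set 'rV[R]_n) :
  closed U -> measurable U.
Proof.
by move=> cU; rewrite -[U]setCK; apply: measurableC; apply: open_measurable_rV;
  exact: closed_openC.
Qed.

Lemma continuous_open_measurable_rV {R : realType} {n : nat}
    (U : set 'rV[R]_n) (f : 'rV[R]_n -> R) :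
  open U -> (forall x, U x -> {for x, continuous f}) -> measurable_fun U f.
Proof.
move=> oU cf; apply: (measurability _ (RGenOpens.measurableE R)).
move=> _ [_ [a [b ->]] <-].
apply: open_measurable_rV; rewrite openE => x [Ux /= fx].
apply: filterI; first exact: open_nbhs_nbhs.
apply: (cf _ Ux); apply: open_nbhs_nbhs; split => //; exact: interval_open.
Qed.

(** * Lebesgue measure of boxes and change of variables in one coordinate *)

Lemma rV_cons_head {R : realType} {n : nat} (t : R) (y : 'rV[R]_n) :
  rV_cons (t, y) 0 ord0 = t.
Proof. exact: (congr1 fst (rV_consK (t, y))). Qed.

Lemma rV_cons_tail {R : realType} {n : nat} (t : R) (y : 'rV[R]_n) j :
  rV_cons (t, y) 0 (lift ord0 j) = y 0 j.
Proof. by have /rowP/(_ j) := congr1 snd (rV_consK (t, y)); rewrite mxE. Qed.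

Lemma integral_rV_cons {R : realType} {n : nat} (F : 'rV[R]_n.+1 -> \bar R) :
  measurable_fun setT F -> (forall x, 0 <= F x)%E ->
  (\int[lebesgue_rV n.+1]_x F x =
   \int[lebesgue_measure]_t \int[lebesgue_rV n]_y F (rV_cons (t, y)))%E.
Proof.
move=> mF F0.
transitivity
    (\int[pushforward (lebesgue_measure \x lebesgue_rV n) rV_cons]_x F x)%E => //.
rewrite (ge0_integral_pushforward measurable_rV_cons)//.
rewrite preimage_setT fubini_tonelli1//; last by move=> x /=.
exact: measurableT_comp mF measurable_rV_cons.
Qed.

Lemma lebesgue_rV_box {R : realType} {n : nat} (c : 'rV[R]_n) (r : 'I_n -> R) :
  (forall i, 0 <= r i) ->
  measurable [set x : 'rV[R]_n | forall i, `|x 0 i - c 0 i| <= r i] /\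
  lebesgue_rV n [set x : 'rV[R]_n | forall i, `|x 0 i - c 0 i| <= r i] =
    (\prod_(i < n) (2 * r i))%:E.
Proof.
elim: n c r => [|n IH] c r r0.
  rewrite (_ : mkset _ = setT); last by apply/seteqP; split => // x _ [].
  by split; [exact: measurableT|rewrite big_ord0 /= diracT].
have [mB IHB] := IH (\row_j c 0 (lift ord0 j)) (fun j => r (lift ord0 j))
  (fun j => r0 (lift ord0 j)).
set B := [set x | _] in mB IHB.
pose I0 : set (measurableTypeR R) := `[c 0 ord0 - r ord0, c 0 ord0 + r ord0]%classic.
have mI0 : measurable I0 by exact: measurable_itv.
set A := [set x : 'rV[R]_n.+1 | _].
have boxE : rV_cons @^-1` A = I0 `*` B.
  apply/seteqP; split=> -[t y] /=.
    move=> h; split => /=.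
      rewrite /I0/= in_itv/= -ler_distl.
      by have := h ord0; rewrite rV_cons_head.
    by move=> j; have := h (lift ord0 j); rewrite rV_cons_tail mxE.
  move=> [/= ht hy] i; have [j ->|->] := unliftP ord0 i.
    by rewrite rV_cons_tail; have := hy j; rewrite mxE.
  by rewrite rV_cons_head ler_distl; move: ht; rewrite /I0/= in_itv.
have mA : measurable A.
  apply: (@measurable_rV_coords _ _
    (fun i => [set t | `|t - c 0 i| <= r i])) => i.
  rewrite (_ : mkset _ = `[c 0 i - r i, c 0 i + r i]%classic).
    exact: measurable_itv.
  by apply/seteqP; split => t /=; rewrite in_itv/= ler_distl.
split => //; rewrite /= /pushforward boxE product_measure1E// [X in (_ * X)%E]IHB.
rewrite [X in (X * _)%E]lebesgue_measure_itv/= lte_fin big_ord_recl EFinM; congr (_ * _)%E.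
case: ltP => [_|h]; first by rewrite -EFinB; congr EFin; ring.
have -> : r ord0 = 0 by have := r0 ord0; lra.
by rewrite mulr0.
Qed.

(** Lebesgue measure on the line is determined by its values on the intervals
    ]a, b], so it is [s] times its image under [t |-> s * t + c]. *)
Lemma integral_affine {R : realType} (s c : R) (G : measurableTypeR R -> \bar R) :
  0 < s -> measurable_fun setT G -> (forall t, 0 <= G t)%E ->
  (\int[lebesgue_measure]_t G (s * t + c)%R =
   s^-1%:E * \int[lebesgue_measure]_t G t)%E.
Proof.
move=> s0 mG G0.
pose f : measurableTypeR R -> measurableTypeR R := fun t => (s * t + c)%R.
have mf : measurable_fun setT f.
  by apply: measurable_funD => //; apply: measurable_funM.
pose k : {nonneg R} := NngNum (ltW s0).
pose pf : {measure set (measurableTypeR R) -> \bar R} :=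
  pushforward lebesgue_measure f.
have key (A : set (measurableTypeR R)) :
    measurable A -> lebesgue_measure A = mscale k (pf mf) A.
  move: A; apply: (@lebesgue_measure_unique R (mscale k (pf mf))) => _ [[a b] _ <-] /=.
  rewrite /mscale /= /pushforward.
  have -> : f @^-1` `]a, b]%classic = `](a - c) / s, (b - c) / s]%classic.
    apply/seteqP; split => t; rewrite /= !in_itv/= /f.
      by rewrite ltr_pdivrMr// ler_pdivlMr// ltrBlDr lerBrDr mulrC.
    by rewrite ltr_pdivrMr// ler_pdivlMr// ltrBlDr lerBrDr mulrC.
  rewrite !lebesgue_measure_itv/= !lte_fin ltr_pM2r ?invr_gt0// ltrD2r.
  case: ifP => _; last by rewrite mule0.
  rewrite -!EFinB -EFinM; congr EFin; field; exact: lt0r_neq0.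
rewrite [in RHS](eq_measure_integral (mscale k (pf mf))); last first.
  by move=> A mA _; exact: key.
rewrite ge0_integral_mscale// (ge0_integral_pushforward mf)// preimage_setT.
by rewrite muleA -EFinM mulVf ?mul1e// gt_eqF.
Qed.

Definition coord_affine {R : realType} {n : nat} (i : 'I_n) (s c : R)
    (x : 'rV[R]_n) : 'rV[R]_n :=
  \row_j (if j == i then s * x 0 j + c else x 0 j).

Lemma coord_affineE {R : realType} {n : nat} (i : 'I_n) (s c : R) (x : 'rV[R]_n) :
  coord_affine i s c x = x + ((s - 1) * x 0 i + c) *: delta_mx 0 i.
Proof.
apply/rowP => j; rewrite !mxE eqxx/=; case: eqP => [->|_] /=; ring.
Qed.

Lemma measurable_coord_affine {R : realType} {n : nat} (i : 'I_n) d
    (T : measurableType d) (s c : T -> measurableTypeR R) (x : T -> 'rV[R]_n) :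
  measurable_fun setT s -> measurable_fun setT c -> measurable_fun setT x ->
  measurable_fun setT (fun w => coord_affine i (s w) (c w) (x w)).
Proof.
move=> ms mc mx; apply: measurable_fun_rVP => j.
have mxj : measurable_fun setT (fun w => x w 0 j).
  exact: measurableT_comp (measurable_coord j) mx.
rewrite (_ : (fun w => _) =
    (fun w => if j == i then s w * x w 0 j + c w else x w 0 j)); last first.
  by apply/funext => w; rewrite mxE.
case: (j == i) => //.
by apply: measurable_funD => //; exact: measurable_funM.
Qed.

(** Induction on the dimension: the measure splits off coordinate 0, which is
    either the transformed coordinate or a parameter. This spares a Fubini
    theorem for an arbitrary coordinate. *)
Lemma integral_coord_affine {R : realType} {n : nat} (i : 'I_n) (s c : R)
    (G : 'rV[R]_n -> \bar R) :
  0 < s -> measurable_fun setT G -> (forall x, 0 <= G x)%E ->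
  (\int[lebesgue_rV n]_x G (coord_affine i s c x) =
   s^-1%:E * \int[lebesgue_rV n]_x G x)%E.
Proof.
move=> s0; elim: n i G => [[]//|n IH] i G mG G0.
have mGi : measurable_fun setT (fun x => G (coord_affine i s c x)).
  by apply: (measurableT_comp mG); apply: measurable_coord_affine.
rewrite integral_rV_cons// [in RHS]integral_rV_cons//.
have mcons t : measurable_fun setT (fun y : 'rV[R]_n => G (rV_cons (t, y))).
  apply: (measurableT_comp mG); apply: measurableT_comp measurable_rV_cons _.
  exact: pair1_measurable.
have mint : measurable_fun setT
    (fun t : measurableTypeR R => \int[lebesgue_rV n]_y G (rV_cons (t, y)))%E.
  apply: (@measurable_fun_fubini_tonelli_F _ _ (measurableTypeR R) 'rV[R]_n R
    (lebesgue_rV n) (G \o rV_cons)) => //; last by move=> x /=.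
  exact: measurableT_comp mG measurable_rV_cons.
have [j ->|->] := unliftP ord0 i.
  rewrite -ge0_integralZl_EFin//; last 2 first.
  - by move=> t _; exact: integral_ge0.
  - by rewrite invr_ge0 ltW.
  apply: eq_integral => t _; rewrite -(IH j)//; apply: eq_integral => y _.
  congr G; apply/rowP => k; rewrite mxE.
  have [k' ->|->] := unliftP ord0 k.
    by rewrite !rV_cons_tail mxE (inj_eq lift_inj).
  by rewrite !rV_cons_head.
apply: (etrans _ (integral_affine c s0 mint _)); last by move=> t; exact: integral_ge0.
apply: eq_integral => t _; apply: eq_integral => y _.
congr G; apply/rowP => k; rewrite mxE.
have [k' ->|->] := unliftP ord0 k.
  by rewrite !rV_cons_tail.
by rewrite !rV_cons_head eqxx.
Qed.

(** * Power inequalities and the increment of a function of one variable *)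

(** The tangent to [t ^ p] at [m] lies below the graph. All terms are written
    with a nonnegative sign, so that the inequality can be integrated in the
    extended reals. *)
Lemma powR_young {R : realType} (p m t : R) : 1 <= p -> 0 <= m -> 0 <= t ->
  p * (m `^ (p - 1)) * t <= t `^ p + (p - 1) * m `^ p.
Proof.
move=> p1 m0 t0; have [->|pN1] := eqVneq p 1.
  by rewrite subrr powRr0 powRr1// mul0r addr0 !mul1r.
have p1' : 0 < p - 1 by rewrite subr_gt0 lt_def pN1.
have p0 : 0 < p by lra.
have q0 : 0 < p / (p - 1) by rewrite divr_gt0.
have pq : p^-1 + (p / (p - 1))^-1 = 1 by field; rewrite !gt_eqF.
have := conjugate_powR t0 (powR_ge0 m (p - 1)) p0 q0 pq.
rewrite -powRrM (_ : (p - 1) * (p / (p - 1)) = p); last first.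
  by field; rewrite gt_eqF.
rewrite -(ler_pM2l p0) => /le_trans/= h.
rewrite -mulrA [m `^ _ * t]mulrC; apply: h.
rewrite le_eqVlt; apply/orP; left; apply/eqP; field.
by rewrite !gt_eqF.
Qed.

Lemma powR_predM {R : realType} (p m : R) : 1 <= p -> 0 <= m ->
  m `^ (p - 1) * m = m `^ p.
Proof.
move=> p1; rewrite le_eqVlt => /orP[/eqP <-|m0].
  by rewrite mulr0 powR0//; apply: lt0r_neq0; lra.
rewrite -[X in _ * X]powRr1 ?ltW// -powRD ?subrK//.
by rewrite (gt_eqF m0) implybT.
Qed.

Lemma powR_add_le {R : realType} (p x y : R) : 1 <= p -> 0 <= x -> 0 <= y ->
  (x + y) `^ p <= 2 `^ (p - 1) * (x `^ p + y `^ p).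
Proof.
move=> p1 x0 y0; set m := (x + y) / 2.
have m0 : 0 <= m by rewrite divr_ge0// addr_ge0.
have hx := powR_young p1 m0 x0; have hy := powR_young p1 m0 y0.
have mp := powR_predM p1 m0.
have key : 2 * m `^ p <= x `^ p + y `^ p.
  have : p * m `^ (p - 1) * x + p * m `^ (p - 1) * y = 2 * p * m `^ p.
    by rewrite -mp /m; field.
  by lra.
rewrite (_ : x + y = 2 * m); last by rewrite /m; field.
rewrite powRM// -(@powR_predM _ p 2)// -mulrA ler_wpM2l// powR_ge0.
Qed.

(** Sum the tangent inequality at the mean of the [x i]. *)
Lemma powR_sum_le {R : realType} {n : nat} (p : R) (x : 'I_n -> R) : 1 <= p ->
  (0 < n)%N -> (forall i, 0 <= x i) ->
  (\sum_i x i) `^ p <= n%:R `^ (p - 1) * \sum_i (x i `^ p).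
Proof.
move=> p1 n0 x0; set m := (\sum_i x i) / n%:R.
have nR : 0 < n%:R :> R by rewrite ltr0n.
have m0 : 0 <= m by apply: divr_ge0; [exact: sumr_ge0|exact: ltW].
have mp := powR_predM p1 m0.
have h : \sum_i (p * (m `^ (p - 1)) * x i) <=
    \sum_i (x i `^ p + (p - 1) * m `^ p).
  by apply: ler_sum => i _; exact: powR_young.
move: h; rewrite -mulr_sumr big_split/= sumr_const card_ord => h.
rewrite -[X in _ <= _ + X]mulr_natl in h.
have sE : \sum_i x i = n%:R * m by rewrite /m; field; rewrite gt_eqF.
have key : n%:R * m `^ p <= \sum_i x i `^ p.
  move: h; rewrite sE (_ : p * _ * _ = p * n%:R * m `^ p); first by lra.
  by rewrite -mp; ring.
have -> : (\sum_i x i) `^ p = n%:R `^ (p - 1) * (n%:R * m `^ p).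
  by rewrite sE (powRM p (ltW nR) m0) -(powR_predM p1 (ltW nR)) mulrA.
by apply: ler_wpM2l => //; exact: powR_ge0.
Qed.

Lemma abs_le_frobenius {R : realType} {m n : nat} (A : 'M[R]_(m, n)) i j :
  `|A i j| <= frobenius A.
Proof.
rewrite /frobenius -sqrtr_sqr ler_sqrt; last first.
  by apply: sumr_ge0 => k _; apply: sumr_ge0 => l _; exact: sqr_ge0.
rewrite (bigD1 i)//= (bigD1 j)//= -addrA lerDl addr_ge0//.
  by apply: sumr_ge0 => k _; exact: sqr_ge0.
by apply: sumr_ge0 => k _; apply: sumr_ge0 => l _; exact: sqr_ge0.
Qed.

Lemma frobenius_ge0 {R : realType} {m n : nat} (A : 'M[R]_(m, n)) :
  0 <= frobenius A.
Proof. exact: sqrtr_ge0. Qed.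

Lemma measurable_frobenius {R : realType} {m n : nat} d (T : measurableType d)
    (D : set T) (A : T -> 'M[R]_(m, n)) :
  (forall i j, measurable_fun D (fun x => A x i j)) ->
  measurable_fun D (fun x => frobenius (A x)).
Proof.
move=> mA; rewrite /frobenius.
have msqrt : measurable_fun setT (Num.sqrt : R -> R).
  by apply: continuous_measurable_fun; exact: sqrt_continuous.
apply: (measurableT_comp msqrt).
apply: measurable_sum => i; apply: measurable_sum => j.
exact: measurable_funX.
Qed.

Lemma frobenius_le_sum {R : realType} {n : nat} (x : 'rV[R]_n) :
  frobenius x <= \sum_i `|x 0 i|.
Proof.
have S0 : 0 <= \sum_i `|x 0 i| by exact: sumr_ge0.
rewrite -[leRHS]ger0_norm// -sqrtr_sqr /frobenius big_ord1 ler_sqrt ?sqr_ge0//.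
rewrite expr2 mulr_suml; apply: ler_sum => i _.
rewrite -real_normK ?num_real// expr2 ler_wpM2l// (bigD1 i)//= lerDl.
exact: sumr_ge0.
Qed.

Lemma frobenius_powR_le {R : realType} {n : nat} (p : R) (x : 'rV[R]_n) :
  1 <= p -> (0 < n)%N ->
  frobenius x `^ p <= n%:R `^ (p - 1) * \sum_i (`|x 0 i| `^ p).
Proof.
move=> p1 n0; apply: le_trans (powR_sum_le p1 n0 (fun i => normr_ge0 (x 0 i))).
apply: ge0_ler_powR; last exact: frobenius_le_sum.
- by lra.
- by rewrite nnegrE frobenius_ge0.
- by rewrite nnegrE; exact: sumr_ge0.
Qed.

(** Jensen's inequality for the mean of [h^`()]: integrate the tangent
    inequality of [powR_young] at the mean slope [m]. *)
Lemma increment_powR {R : realType} (p a b : R) (h k : R -> R) :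
  1 <= p -> a < b -> {within `[a, b], continuous k} ->
  derivable_oo_LRcontinuous h a b -> {in `]a, b[, h^`()%classic =1 k} ->
  ((`|h b - h a| `^ p)%:E <= ((b - a) `^ (p - 1))%:E *
     \int[lebesgue_measure]_(s in `[a, b]) (`|k s| `^ p)%:E)%E.
Proof.
move=> p1 ab ck dh hk.
have ba0 : 0 < b - a by rewrite subr_gt0.
set d := `|h b - h a|.
have ik : lebesgue_measure.-integrable `[a, b] (EFin \o k).
  by apply: continuous_compact_integrable => //; exact: segment_compact.
have mk : measurable_fun `[a, b] k.
  by apply/measurable_EFinP; exact: (measurable_int _ ik).
have mk' : measurable_fun `[a, b] (fun s => `|k s|).
  exact: measurableT_comp mk.
have mkp : measurable_fun `[a, b] (fun s => `|k s| `^ p).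
  exact: (measurableT_comp (@measurable_powR R p) mk').
have d_le : (d%:E <= \int[lebesgue_measure]_(s in `[a, b]) `|k s|%:E)%E.
  have := continuous_FTC2 ab ck dh hk.
  rewrite -EFinB => E; rewrite /d -abse_EFin -E.
  by apply: le_abse_integral => //; exact/measurable_EFinP.
pose m := d / (b - a).
have m0 : 0 <= m by apply: divr_ge0; [exact: normr_ge0|exact: ltW].
have mub : lebesgue_measure (`[a, b]%classic : set R) = (b - a)%:E.
  by rewrite lebesgue_measure_itv/= lte_fin ab EFinB.
set J := (\int[_]_(_ in _) _)%E.
have J0 : (0 <= J)%E by apply: integral_ge0 => s _; rewrite lee_fin powR_ge0.
have [->|Jfin] := eqVneq J +oo%E.
  by rewrite gt0_muley ?leey// lte_fin powR_gt0.
have {Jfin}Jf : J \is a fin_num by rewrite ge0_fin_numE// lt_neqAle Jfin leey.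
have key : ((p * m `^ (p - 1))%:E * \int[lebesgue_measure]_(s in `[a, b]) `|k s|%:E
    <= J + ((p - 1) * m `^ p * (b - a))%:E)%E.
  rewrite -ge0_integralZl_EFin//; last 2 first.
  - exact/measurable_EFinP.
  - by rewrite mulr_ge0 ?powR_ge0//; lra.
  rewrite [X in (_ + X)%E]EFinM -mub -integral_cst//.
  rewrite -ge0_integralD//; last 2 first.
  - exact/measurable_EFinP.
  - by move=> s _ /=; rewrite lee_fin mulr_ge0 ?powR_ge0//; lra.
  apply: ge0_le_integral => //.
  - by move=> s _; rewrite -EFinM lee_fin !mulr_ge0 ?powR_ge0//; lra.
  - by apply/measurable_EFinP; exact: measurable_funM.
  - by apply/measurable_EFinP; exact: measurable_funD.
  - by move=> s _ /=; rewrite -EFinM -EFinD lee_fin; exact: powR_young.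
have {key} : ((p * m `^ (p - 1))%:E * d%:E
    <= J + ((p - 1) * m `^ p * (b - a))%:E)%E.
  apply: le_trans key; apply: lee_pmul => //; rewrite lee_fin.
    by rewrite mulr_ge0 ?powR_ge0//; lra.
  exact: normr_ge0.
move: Jf => /fineK <-; rewrite -EFinM -EFinD -EFinM !lee_fin => key.
have dE : d = (b - a) * m by rewrite /m; field; rewrite gt_eqF.
rewrite {1}dE powRM ?(ltW ba0)// -(@powR_predM _ p (b - a)) ?(ltW ba0)//.
rewrite -mulrA ler_wpM2l ?powR_ge0//.
move: key; rewrite dE (_ : p * _ * _ = p * (b - a) * m `^ p); first by lra.
by rewrite -(powR_predM p1 m0); ring.
Qed.

(** * Hausdorff measure *)

Lemma hausdorff_delta_anti {R : realType} {n : nat} (s : nat) (d1 d2 : R)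
    (A : set 'rV[R]_n) : d1 <= d2 ->
  (hausdorff_delta s d2 A <= hausdorff_delta s d1 A)%E.
Proof.
move=> d12; apply: ereal_inf_le_tmp => _ [F [CF AF] <-]; exists F => //.
split => // k; have /le_trans := CF k; apply.
by rewrite lee_fin.
Qed.

Lemma hausdorff_delta_le {R : realType} {n : nat} (s : nat) (d : R)
    (A : set 'rV[R]_n) : 0 < d -> (hausdorff_delta s d A <= hausdorff s A)%E.
Proof. by move=> d0; apply: ereal_sup_ubound; exists d. Qed.

Lemma norm_le_frobenius {R : realType} {n : nat} (x : 'rV[R]_n) :
  `|x| <= frobenius x.
Proof.
rewrite [leLHS]/Num.norm /= mx_normrE; apply/bigmax_leP; split => [|[i j] _ /=].
  exact: frobenius_ge0.
exact: abs_le_frobenius.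
Qed.

Lemma frobenius_le_ediam {R : realType} {n : nat} (A : set 'rV[R]_n) x y :
  A x -> A y -> ((frobenius (x - y))%:E <= ediam A)%E.
Proof. by move=> Ax Ay; apply: ereal_sup_ubound; exists (x, y). Qed.

(** A set of diameter less than [r] cannot meet both [A] and [B], because the
    Euclidean norm dominates the sup norm; so a fine cover of the union splits
    into a cover of [A] and one of [B]. *)
Lemma hausdorff_metric {R : realType} {n : nat} (s : nat) (A B : set 'rV[R]_n)
    (r : R) : 0 < r -> (forall a b, A a -> B b -> r <= `|a - b|) ->
  (hausdorff s A + hausdorff s B <= hausdorff s (A `|` B))%E.
Proof.
move=> r0 AB.
have hd0 d E : (0 <= hausdorff_delta s d E :> \bar R)%E.
  by apply: cover_outer_ge0 => F; exact: hausdorff_gauge_ge0.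
have step d : 0 < d -> d < r ->
    (hausdorff_delta s d A + hausdorff_delta s d B <= hausdorff s (A `|` B))%E.
  move=> d0 dr; apply: le_trans (hausdorff_delta_le s (A `|` B) d0).
  apply: le_ereal_inf_tmp => _ [F [CF ABF] <-].
  pose FF (E : set 'rV[R]_n) k := if pselect (F k `&` E !=set0) then F k else set0.
  have C0 : [set E : set 'rV[R]_n | (ediam E <= d%:E)%E] set0.
    by rewrite /= /ediam setX0 image_set0 ereal_sup0 leNye.
  have hE E : E `<=` A `|` B -> (hausdorff_delta s d E <=
      \sum_(k <oo) hausdorff_gauge s (FF E k))%E.
    move=> EAB; apply: ereal_inf_lbound; exists (FF E) => //; split.
      by move=> k; rewrite /FF; case: pselect => //= _; exact: CF.
    move=> x Ex; have [k _ Fkx] := ABF _ (EAB _ Ex); exists k => //.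
    by rewrite /FF; case: pselect => // -[]; exists x.
  apply: le_trans (leeD (hE A (@subsetUl _ _ _)) (hE B (@subsetUr _ _ _))) _.
  rewrite -nneseriesD; last 2 first.
  - by move=> k _ _; exact: hausdorff_gauge_ge0.
  - by move=> k _ _; exact: hausdorff_gauge_ge0.
  apply: lee_nneseries => [k _ _|k _].
    by rewrite adde_ge0//; exact: hausdorff_gauge_ge0.
  have w0 : hausdorff_gauge s (set0 : set 'rV[R]_n) = 0%E.
    by rewrite /hausdorff_gauge eqxx.
  rewrite /FF; case: pselect => /= hA; case: pselect => /= hB.
  - have [[a [Fa Aa]] [b [Fb Bb]]] := (hA, hB).
    have : (r%:E <= d%:E)%E.
      apply: le_trans (CF k); apply: le_trans (frobenius_le_ediam Fa Fb).
      by rewrite lee_fin; apply: le_trans (norm_le_frobenius _); exact: AB.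
    by rewrite lee_fin leNgt dr.
  - by rewrite w0 adde0.
  - by rewrite w0 add0e.
  - by rewrite w0 adde0; exact: hausdorff_gauge_ge0.
have [->|Hfin] := eqVneq (hausdorff s (A `|` B)) +oo%E; first exact: leey.
set c := hausdorff s (A `|` B) in step Hfin *.
have c0 : (0 <= c)%E by exact: (outer_measure_ge0 (hausdorff_outer s)).
have cf : c \is a fin_num by rewrite ge0_fin_numE// lt_neqAle Hfin leey.
have step2 d1 d2 : 0 < d1 -> 0 < d2 ->
    (hausdorff_delta s d1 A + hausdorff_delta s d2 B <= c)%E.
  move=> d10 d20; pose d := Num.min (r / 2) (Num.min d1 d2).
  have hd : 0 < d by rewrite !lt_min d10 d20 divr_gt0.
  apply: le_trans (step d _ _) => //.
    by apply: leeD; apply: hausdorff_delta_anti; rewrite /d !ge_min lexx ?orbT.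
  by rewrite /d gt_min; apply/orP; left; lra.
have fB d2 : 0 < d2 -> hausdorff_delta s d2 B \is a fin_num.
  move=> d20; rewrite ge0_fin_numE//; apply: (@le_lt_trans _ _ c); last by rewrite ltey_eq cf.
  by apply: le_trans (step2 1 d2 ltr01 d20); rewrite leeDr.
have H1 d2 : 0 < d2 -> (hausdorff s A + hausdorff_delta s d2 B <= c)%E.
  move=> d20; rewrite -leeBrDr ?fB//; apply: ge_ereal_sup => _ [d1 d10 <-].
  by rewrite leeBrDr ?fB//; exact: step2.
have fA : hausdorff s A \is a fin_num.
  rewrite ge0_fin_numE; last exact: (outer_measure_ge0 (hausdorff_outer s)).
  apply: (@le_lt_trans _ _ c); last by rewrite ltey_eq cf.
  by apply: le_trans (H1 1 ltr01); rewrite leeDl.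
rewrite addeC -leeBrDr//; apply: ge_ereal_sup => _ [d2 d20 <-].
by rewrite leeBrDr// addeC; exact: H1.
Qed.

(** Caratheodory's criterion, for [mu X] finite. The set [D k] is the part of
    [X] at distance at least [e k] from [C], so that additivity applies to it
    and [X `&` C]. What [D k.+1] misses of [X `&` ~` C] is covered by the shells
    [S j], [j >= k]. There is a gap between [S k] and [D k], and both lie in
    [D k.+2], so that [mu (D k) + mu (S k) <= mu (D k.+2)]: hence the measures
    of the shells sum to at most [2 * mu X], and the tails of this sum tend to
    0. *)
Lemma closed_caratheodory {R : realType} {n : nat}
    (mu : {outer_measure set 'rV[R]_n -> \bar R}) :
  (forall (A B : set 'rV[R]_n) (r : R), 0 < r ->
     (forall a b, A a -> B b -> r <= `|a - b|) ->
     (mu A + mu B <= mu (A `|` B))%E) ->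
  forall C, closed C -> mu.-caratheodory C.
Proof.
move=> metric C closedC; apply: le_caratheodory_measurable => X.
have [->|Xfin] := eqVneq (mu X) +oo%E; first exact: leey.
have Xf : mu X \is a fin_num.
  by rewrite ge0_fin_numE ?outer_measure_ge0// lt_neqAle Xfin leey.
pose e k : R := k.+1%:R^-1.
have e0 k : 0 < e k by rewrite invr_gt0.
have e_lt k : e k.+1 < e k by rewrite ltf_pV2 ?posrE// ltr_nat.
pose N k : set 'rV[R]_n := [set x | exists2 y, C y & `|x - y| < e k].
pose D k := X `&` ~` N k.
have NS k : N k.+1 `<=` N k.
  by move=> x [y Cy xy]; exists y => //; exact: lt_trans xy (e_lt k).
have Nmono k l : (k <= l)%N -> N l `<=` N k.
  move=> /subnK <-; elim: (l - k)%N => // m IH x; rewrite addSn => /NS; exact: IH.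
have CN k : C `<=` N k by move=> x Cx; exists x => //; rewrite subrr normr0.
have gap k (A B : set 'rV[R]_n) : A `<=` ~` N k -> B `<=` N k.+1 ->
    (mu A + mu B <= mu (A `|` B))%E.
  move=> AN BN; apply: (metric _ _ (e k - e k.+1)); first by rewrite subr_gt0.
  move=> a b Aa Bb; have [y Cy yb] := BN _ Bb.
  have ya : e k <= `|a - y|.
    by rewrite leNgt; apply/negP => ay; apply: (AN _ Aa); exists y.
  rewrite lerBlDr; apply: (le_trans ya).
  rewrite (_ : a - y = (a - b) + (b - y)); last by rewrite addrA subrK.
  by apply: (le_trans (ler_normD _ _)); rewrite lerD2l ltW.
pose S k := X `&` (N k.+1 `\` N k.+2).
pose a k := mu (S k).
have a0 k : (0 <= a k)%E by exact: outer_measure_ge0.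
have DX k : (mu (D k) <= mu X)%E.
  by apply: le_outer_measure => x [].
have sum_a m : (\sum_(0 <= k < m) a k <= mu (D m) + mu (D m.+1))%E.
  elim: m => [|m IH]; first by rewrite big_geq// adde_ge0 ?outer_measure_ge0.
  rewrite big_nat_recr//=; apply: (le_trans (leeD IH (lexx (a m)))).
  rewrite addeAC addeC leeD2l//.
  apply: le_trans (gap m (D m) (S m) _ _) _ => [x []//|x [_ []]//|].
  apply: le_outer_measure => x [[Xx nNx]|[Xx [_ nNx]]]; split => //.
  by move=> Nx; apply: nNx; apply: (Nmono m m.+2) => //; rewrite leqW.
have suma_fin : (\sum_(0 <= k <oo) a k < +oo)%E.
  apply: (@le_lt_trans _ _ (mu X + mu X)%E).
    apply: lime_le; first by apply: is_cvg_nneseries => k _ _; exact: a0.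
    by near=> m; apply: le_trans (sum_a m) _; exact: leeD.
  by rewrite ltey_eq fin_numD Xf.
have bound k : (mu (X `&` C) + mu (X `&` ~` C) <=
    mu X + \sum_(k <= j <oo) a j)%E.
  have cover : X `&` ~` C `<=` D k.+1 `|` \bigcup_(j in ~` `I_k) S j.
    move=> x [Xx nCx]; have [Nx|nNx] := pselect (N k.+1 x); last by left.
    right.
    have [l nNl] : exists l, ~ N l x.
      apply: contrapT => /forallNP h; apply: nCx.
      rewrite (closure_id C).1//= => V /nbhs_ballP[r /= r0 rV].
      have [l lr] : exists l, e l < r.
        have [l _ /(_ l)/= hl] := near_infty_natSinv_lt (PosNum r0).
        by exists l; apply: hl => /=.
      have /contrapT[y Cy xy] := h l; exists y; split => //; apply: rV.
      by rewrite -ball_normE /=; exact: lt_trans lr.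
    have exl : exists l, ~~ `[< N l x >] by exists l; apply/asboolP.
    case: (ex_minnP exl) => m /asboolP nNm mmin.
    (* [m] is the first index with [x] outside [N m], so [x] lies in [S m.-2] *)
    have km : (k.+1 < m)%N.
      by rewrite ltnNge; apply/negP => mk; apply: nNm; exact: Nmono Nx.
    exists m.-2.
      rewrite /=; apply/negP; rewrite -leqNgt.
      by case: m km {mmin nNm} => [|[|m]].
    split => //; case: m km nNm mmin => [|[|m]]// km nNm mmin; split => //=.
    apply: contrapT => nN1; have := mmin m.+1; rewrite ltnn => h.
    by have := h (introT (asboolPn _) nN1).
  apply: (@le_trans _ _ (mu (X `&` C) + (mu (D k.+1) + \sum_(k <= j <oo) a j))%E).
    rewrite leeD2l//; apply: (le_trans (le_outer_measure _ _ _ cover)).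
    apply: (le_trans (outer_measureU2 _ _ _)); rewrite leeD2l//.
    exact: outer_measure_sigma_subadditive_tail.
  rewrite addeA leeD2r// addeC.
  apply: le_trans (gap k.+1 (D k.+1) (X `&` C) _ _) _ => [x []//|x [_ /CN]//|].
  by apply: le_outer_measure => x [[]|[]].
have tail := nneseries_tail_cvg suma_fin (fun k _ => a0 k).
have : (fun k => mu X + \sum_(k <= j <oo) a j)%E @ \oo --> (mu X + 0)%E.
  by apply: cvgeD => //; [rewrite fin_num_adde_defl|exact: cvg_cst].
rewrite adde0 => cv.
rewrite -(cvg_lim _ cv)//; apply: lime_ge; first by apply/cvg_ex; eexists; exact: cv.
by near=> k; exact: bound.
Unshelve. all: by end_near. Qed.

Lemma unit_ball_volume_gt0 {R : realType} (s : nat) :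
  exists2 k : R, 0 < k & (k%:E <= unit_ball_volume s)%E.
Proof.
(* the volume of the cube of half-side [s.+1%:R^-1], contained in the ball *)
exists (\prod_(i < s) (2 * s.+1%:R^-1)).
  by apply: prodr_gt0 => i _; rewrite mulr_gt0// invr_gt0.
have r0 (i : 'I_s) : 0 <= (s.+1%:R^-1 : R) by [].
have [mB <-] := lebesgue_rV_box (0 : 'rV[R]_s) r0.
apply: le_measure; rewrite ?inE//.
  rewrite -[X in measurable X]setTI.
  rewrite (_ : mkset _ = @frobenius R 1 s @^-1` `]-oo, 1[%classic); last first.
    by apply/seteqP; split => x /=; rewrite in_itv.
  have mf : measurable_fun setT (fun x : 'rV[R]_s => frobenius x).
    by apply: measurable_frobenius => j k; rewrite ord1; exact: measurable_coord.
  exact: mf.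
move=> x /= xs; apply: (le_lt_trans (frobenius_le_sum x)).
apply: (@le_lt_trans _ _ (\sum_(i < s) s.+1%:R^-1)).
  by apply: ler_sum => i _; have := xs i; rewrite mxE subr0.
by rewrite sumr_const card_ord -[X in X < _]mulr_natl ltr_pdivrMr ?mul1r ?ltr_nat.
Qed.

(** Both sides scale like the [n.-1]-th power of the diameter [d] of [F]. The
    set above [F] is replaced by a box, so that no projection of [F] needs to
    be measurable. *)
Lemma cylinder_le_gauge {R : realType} {n : nat} (i : 'I_n) (M : R) : 0 <= M ->
  exists2 K : R, 0 < K & forall F : set 'rV[R]_n, (ediam F <= 1%:E)%E ->
    exists2 B : set 'rV[R]_n, measurable B &
      [set x : 'rV[R]_n | `|x 0 i| <= M /\
          exists2 y, F y & forall j, j != i -> x 0 j = y 0 j]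
        `<=` B /\ (lebesgue_rV n B <= K%:E * hausdorff_gauge n.-1 F)%E.
Proof.
move=> M0; have [k k0 hk] := @unit_ball_volume_gt0 R n.-1.
(* the ratio of [2 * M * (2 * d) ^+ n.-1] and [k * (d / 2) ^+ n.-1]; the
   summand 1 makes it positive when [M = 0] *)
exists (2 * M * 4 ^+ n.-1 / k + 1) => [|F F1].
  by rewrite ltr_pwDr// divr_ge0 ?(ltW k0)// !mulr_ge0// exprn_ge0.
have [->|/set0P[c Fc]] := eqVneq F set0.
  exists set0; first exact: measurable0.
  split; first by move=> x [_ [y []]].
  by rewrite measure0 /hausdorff_gauge eqxx mule0.
have dfin : ediam F \is a fin_num.
  rewrite ge0_fin_numE; first by rewrite (le_lt_trans F1)// ltry.
  by apply: le_trans (frobenius_le_ediam Fc Fc); rewrite lee_fin frobenius_ge0.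
pose d := fine (ediam F).
have dE : ediam F = d%:E by rewrite fineK.
have dist y : F y -> frobenius (y - c) <= d.
  by move=> Fy; rewrite -lee_fin -dE; exact: frobenius_le_ediam.
have d0 : 0 <= d by apply: le_trans (dist c Fc); exact: frobenius_ge0.
pose r j := if j == i then M else d.
have r0 j : 0 <= r j by rewrite /r; case: ifP.
pose c' : 'rV[R]_n := \row_j (if j == i then 0 else c 0 j).
have [mB muB] := lebesgue_rV_box c' r0.
exists [set x | forall j, `|x 0 j - c' 0 j| <= r j] => //; split.
  move=> x [xM [y Fy xy]] j; rewrite mxE /r; case: eqP => [->|/eqP ji].
    by rewrite subr0.
  rewrite (xy _ ji); apply: le_trans (dist y Fy).
  by have := abs_le_frobenius (y - c) 0 j; rewrite !mxE.
rewrite muB /hausdorff_gauge ifF; last by apply/negP => /eqP F0; rewrite F0 in Fc.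
have -> : \prod_(j < n) (2 * r j) = 2 * M * (2 * d) ^+ n.-1.
  rewrite (bigD1 i)//= {1}/r eqxx; congr (_ * _).
  rewrite (eq_bigr (fun=> 2 * d)); last by move=> j /negbTE ji; rewrite /r ji.
  by rewrite prodr_const (cardC1 i) card_ord.
apply: (@le_trans _ _ ((2 * M * 4 ^+ n.-1 / k + 1)%:E * (k%:E * ((d / 2) ^+ n.-1)%:E))%E).
  rewrite -!EFinM lee_fin.
  rewrite (_ : 2 * M * (2 * d) ^+ n.-1 = 2 * M * 4 ^+ n.-1 / k * (k * (d / 2) ^+ n.-1)).
    by rewrite ler_wpM2r ?lerDl// mulr_ge0 ?(ltW k0)// exprn_ge0// divr_ge0.
  rewrite (_ : 2 * d = 4 * (d / 2)); last by field.
  by rewrite exprMn; field; rewrite gt_eqF.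
apply: lee_pmul => //.
- by rewrite lee_fin addr_ge0// divr_ge0 ?(ltW k0)// !mulr_ge0// exprn_ge0.
- by rewrite -EFinM lee_fin mulr_ge0 ?(ltW k0)// exprn_ge0// divr_ge0.
apply: lee_pmul => //.
- by rewrite lee_fin ltW.
- by rewrite lee_fin exprn_ge0// divr_ge0.
- by rewrite dE -EFinM -EFin_expe.
Qed.

(** Projecting [E] along the axis [i] does not increase its Hausdorff measure by
    more than a constant, expressed through the cylinder above [E]: cover [E]
    and replace each covering set by the box of [cylinder_le_gauge]. *)
Lemma slab_le_hausdorff {R : realType} {n : nat} (i : 'I_n) (M : R) : 0 <= M ->
  exists2 K : R, 0 < K & forall (W E : set 'rV[R]_n), measurable W ->
    (forall x, W x -> `|x 0 i| <= M /\
       exists2 y, E y & forall j, j != i -> x 0 j = y 0 j) ->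
    (lebesgue_rV n W <= K%:E * hausdorff n.-1 E)%E.
Proof.
move=> M0; have [K K0 hK] := cylinder_le_gauge i M0; exists K => // W E mW WE.
apply: (@le_trans _ _ (K%:E * hausdorff_delta n.-1 1 E)%E); last first.
  by apply: lee_wpmul2l; [rewrite lee_fin ltW|exact: hausdorff_delta_le].
rewrite -lee_pdivrMl//; apply: le_ereal_inf_tmp => _ [F [F1 EF] <-].
rewrite lee_pdivrMl// -nneseriesZl; last first.
  by move=> k _; exact: hausdorff_gauge_ge0.
have /choice[B hB] : forall k, exists B : set 'rV[R]_n, measurable B /\
      [set x : 'rV[R]_n | `|x 0 i| <= M /\
          exists2 y, F k y & forall j, j != i -> x 0 j = y 0 j]
        `<=` B /\ (lebesgue_rV n B <= K%:E * hausdorff_gauge n.-1 (F k))%E.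
  by move=> k; have [B mB h] := hK _ (F1 k); exists B.
apply: (@le_trans _ _ (\sum_(k <oo) lebesgue_rV n (B k))%E).
  apply: measure_sigma_subadditive => // [k|x Wx]; first exact: (hB k).1.
  have [xM [y Ey xy]] := WE _ Wx; have [k _ Fky] := EF _ Ey; exists k => //.
  by apply: (hB k).2.1; split => //; exists y.
by apply: lee_nneseries => [k _ _|k _]; [exact: measure_ge0|exact: (hB k).2.2].
Qed.

(** Both integrals are integrals of the identity over ]0, +oo[ for the
    distributions of [f1] and [f2]. This compares integrals for measures that
    live on different spaces, or on one space with different sigma-algebras. *)
Lemma integral_le_distribution {R : realType} d1 d2 (T1 : measurableType d1)
    (T2 : measurableType d2) (m1 : {measure set T1 -> \bar R})
    (m2 : {measure set T2 -> \bar R}) (D1 : set T1) (D2 : set T2)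
    (f1 : T1 -> R) (f2 : T2 -> R) (K : R) :
  measurable D1 -> measurable D2 -> measurable_fun D1 f1 ->
  measurable_fun D2 f2 -> (forall x, 0 <= f1 x) -> (forall x, 0 <= f2 x) ->
  0 <= K ->
  (forall A, measurable A ->
    (m1 (D1 `&` f1 @^-1` A) <= K%:E * m2 (D2 `&` f2 @^-1` A))%E) ->
  (\int[m1]_(x in D1) (f1 x)%:E <= K%:E * \int[m2]_(x in D2) (f2 x)%:E)%E.
Proof.
move=> mD1 mD2 mf1 mf2 f10 f20 K0 le12.
pose S : set R := `]0, +oo[%classic.
have mS : measurable S by exact: measurable_itv.
have pt0 : (point : R) = 0 by [].
have push d (T : measurableType d) (m : {measure set T -> \bar R}) (D : set T)
    (f : T -> R) (mD : measurable D) (mf : measurable_fun setT (f \_ D)) :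
    (forall x, 0 <= f x) ->
    (\int[m]_(x in D) (f x)%:E =
     \int[mrestr (pushforward m (f \_ D)) mS]_(t in S) `|t|%:E)%E.
  move=> f0; rewrite [RHS](@eq_measure_integral _ _ _ _ (pushforward m (f \_ D))); last first.
    by move=> A mA AS; rewrite /= /mrestr setIidl.
  rewrite (ge0_integral_pushforward mf)//; last first.
    by apply/measurable_EFinP; exact: (measurableT_comp (@normr_measurable R setT)).
  rewrite integral_mkcond [RHS]integral_mkcond; apply: eq_integral => x _.
  rewrite !patchE /=; case: ifPn => xD; case: ifPn => //=.
  - by rewrite patchE xD ger0_norm.
  - rewrite notin_setE /= /S /= patchE xD in_itv /= andbT => /negP.
    rewrite -leNgt => fx; congr EFin; apply/eqP; rewrite eq_le fx.
    exact: f0.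
  - move/set_mem => /=; rewrite patchE (negbTE xD) /S /=.
    by rewrite in_itv/= pt0 ltxx.
have mf1' : measurable_fun setT (f1 \_ D1) by exact: (measurable_restrictT _ mD1).1.
have mf2' : measurable_fun setT (f2 \_ D2) by exact: (measurable_restrictT _ mD2).1.
rewrite (push _ _ m1 _ _ mD1 mf1')// (push _ _ m2 _ _ mD2 mf2')//.
have mabs : measurable_fun setT (fun t : R => `|t|%:E).
  by apply/measurable_EFinP; exact: normr_measurable.
rewrite -(ge0_integral_mscale _ mS (NngNum K0))//; last exact: measurable_funTS.
apply: ge0_le_measure_integral => // A mA.
have preE T (D : set T) (f : T -> R) :
    f \_ D @^-1` (A `&` S) = D `&` f @^-1` (A `&` S).
  apply/seteqP; split => x /=; rewrite patchE.
    case: ifPn => [/set_mem//|_ [_]]; by rewrite /S /= in_itv/= pt0 ltxx.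
  by move=> [Dx fx]; rewrite mem_set.
rewrite /= /mscale /= /mrestr /= /pushforward !preE.
by apply: le12; exact: measurableI.
Qed.

(** * Exit from a bounded open set along a coordinate direction *)

Definition line {R : realType} {n : nat} (i : 'I_n) (x : 'rV[R]_n) (s : R) :
  'rV[R]_n := x + s *: delta_mx 0 i.

(** The infimum is 0 outside [Omega], which makes the exit time a measurable
    function on the whole space. *)
Definition exit_time {R : realType} {n : nat} (Omega : set 'rV[R]_n) (i : 'I_n)
    (x : 'rV[R]_n) : R :=
  inf [set s | 0 <= s /\ ~ Omega (line i x (- s))].

Definition exit_point {R : realType} {n : nat} (Omega : set 'rV[R]_n) (i : 'I_n)
    (x : 'rV[R]_n) : 'rV[R]_n :=
  line i x (- exit_time Omega i x).

Lemma line_coord {R : realType} {n : nat} (i j : 'I_n) (x : 'rV[R]_n) (s : R) :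
  (line i x s) 0 j = x 0 j + (if j == i then s else 0).
Proof. by rewrite !mxE eqxx/=; case: eqP => _ /=; rewrite ?mulr1 ?mulr0. Qed.

Lemma line_affine {R : realType} {n : nat} (i : 'I_n) (x : 'rV[R]_n) (s : R) :
  line i x s = coord_affine i 1 s x.
Proof. by rewrite coord_affineE subrr mul0r add0r. Qed.

Lemma line_continuous {R : realType} {n : nat} (i : 'I_n) (x : 'rV[R]_n) :
  continuous (line i x).
Proof.
move=> s; apply: cvgD; first exact: cvg_cst.
by apply: cvgZ; [exact: cvg_id|exact: cvg_cst].
Qed.

Lemma line2_continuous {R : realType} {n : nat} (i : 'I_n) :
  continuous (fun p : R * 'rV[R]_n => line i p.2 (- p.1)).
Proof.
move=> [s x]; apply: cvgD; first exact: cvg_snd.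
by apply: cvgZ; [apply: cvgN; exact: cvg_fst|exact: cvg_cst].
Qed.

(** The infimum is attained because the complement of [Omega] is closed. *)
Lemma exit_timeP {R : realType} {n : nat} (Omega : set 'rV[R]_n) (i : 'I_n)
    (M : R) (x : 'rV[R]_n) :
  open Omega -> (forall y, Omega y -> `|y 0 i| <= M) ->
  [/\ 0 <= exit_time Omega i x, ~ Omega (exit_point Omega i x) &
      forall s, 0 <= s -> s < exit_time Omega i x -> Omega (line i x (- s))].
Proof.
move=> oO OM; set S := [set s | 0 <= s /\ ~ Omega (line i x (- s))].
have lbS : lbound S 0 by move=> s [].
have S0 : S !=set0.
  exists (`|x 0 i| + `|M| + 1); split; first by rewrite !addr_ge0.
  move=> /OM; rewrite line_coord eqxx ler_norml => /andP[h _].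
  have := ler_norm (x 0 i); have := ler_norm M; lra.
have infS : has_inf S by split => //; exists 0.
have hlb : has_lbound S by exists 0.
have t0 : 0 <= exit_time Omega i x by exact: lb_le_inf.
split => // [Oe|s s0 st]; last first.
  apply: contrapT => nO; have : exit_time Omega i x <= s by apply: ge_inf.
  by rewrite leNgt st.
have : nbhs (exit_time Omega i x) (fun s => Omega (line i x (- s))).
  have cf : {for exit_time Omega i x, continuous (fun s => line i x (- s))}.
    apply: (@continuous_comp _ _ _ -%R (line i x)); first exact: opp_continuous.
    exact: line_continuous.
  by apply: cf; apply: open_nbhs_nbhs.
move=> /nbhs_ballP[e /= e0 he].
have [s Ss se] := inf_adherent e0 infS.
have ts : exit_time Omega i x <= s by exact: ge_inf.
case: Ss => _; apply; apply: he; rewrite /ball /= ler0_norm ?subr_le0//.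
by rewrite opprB ltrBlDl.
Qed.

(** After time [2 * M + 1] the line has left the slab containing [Omega]. *)
Lemma exit_time_le {R : realType} {n : nat} (Omega : set 'rV[R]_n) (i : 'I_n)
    (M : R) (x : 'rV[R]_n) :
  (forall y, Omega y -> `|y 0 i| <= M) -> Omega x ->
  exit_time Omega i x <= 2 * M + 1.
Proof.
move=> OM Ox; apply: ge_inf; first by exists 0 => s [].
have := OM _ Ox; rewrite ler_norml => /andP[h1 h2].
split; first by lra.
by move=> /OM; rewrite line_coord eqxx ler_norml => /andP[h3 _]; lra.
Qed.

Lemma exit_time_gt0 {R : realType} {n : nat} (Omega : set 'rV[R]_n)
    (i : 'I_n) (M : R) (x : 'rV[R]_n) :
  open Omega -> (forall y, Omega y -> `|y 0 i| <= M) -> Omega x ->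
  0 < exit_time Omega i x.
Proof.
move=> oO OM Ox; have [t0 nO _] := exit_timeP x oO OM.
rewrite lt_neqAle t0 andbT; apply/eqP => te; apply: nO.
by rewrite /exit_point -te oppr0 /line scale0r addr0.
Qed.

Lemma exit_point_boundary {R : realType} {n : nat} (Omega : set 'rV[R]_n)
    (i : 'I_n) (M : R) (x : 'rV[R]_n) :
  open Omega -> (forall y, Omega y -> `|y 0 i| <= M) -> Omega x ->
  boundary Omega (exit_point Omega i x).
Proof.
move=> oO OM Ox; have [t0 nO OO] := exit_timeP x oO OM.
split; last by move=> /interior_subset.
have tpos := exit_time_gt0 oO OM Ox.
move=> V nV.
have : nbhs (exit_time Omega i x) (fun s => V (line i x (- s))).
  have cf : {for exit_time Omega i x, continuous (fun s => line i x (- s))}.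
    apply: (@continuous_comp _ _ _ -%R (line i x)); first exact: opp_continuous.
    exact: line_continuous.
  exact: cf.
move=> /nbhs_ballP[e /= e0 he].
pose s := Num.max 0 (exit_time Omega i x - e / 2).
exists (line i x (- s)); split.
  apply: OO; first by rewrite le_max lexx.
  by rewrite gt_max tpos; lra.
apply: he; rewrite /ball /= /s.
have [h|h] := leP 0 (exit_time Omega i x - e / 2).
  by rewrite ger0_norm; lra.
by rewrite subr0 ger0_norm//; lra.
Qed.

(** The exit time is lower semicontinuous: it exceeds [c] at [x] exactly when the
    compact segment covered up to time [c] lies in the open set [Omega], which
    persists for nearby points. *)
Lemma measurable_exit_time {R : realType} {n : nat} (Omega : set 'rV[R]_n)
    (i : 'I_n) (M : R) :
  open Omega -> (forall y, Omega y -> `|y 0 i| <= M) ->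
  measurable_fun setT (exit_time Omega i).
Proof.
move=> oO OM; apply: (measurability _ (RGenOInfty.measurableE R)).
move=> _ [_ [c ->] <-]; rewrite setTI.
apply: open_measurable_rV.
have -> : exit_time Omega i @^-1` `]c, +oo[%classic =
    [set x | `[0, c]%classic `<=` [set s | Omega (line i x (- s))]].
  apply/seteqP; split => x /=; rewrite in_itv/= andbT;
    have [t0 nO OO] := exit_timeP x oO OM.
    move=> ct s; rewrite /= in_itv/= => /andP[s0 sc].
    by apply: OO => //; exact: le_lt_trans ct.
  move=> h; rewrite ltNge; apply/negP => tc; apply: nO.
  by apply: (h (exit_time Omega i x)); rewrite /= in_itv/= t0.
rewrite openE => x0 h /=.
have := (compact_near_coveringP `[0, c]%classic).1 (@segment_compact _ 0 c).
move=> /(_ _ (nbhs x0) (fun x s => Omega (line i x (- s)))); apply.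
move=> s sc; have := @line2_continuous R n i (s, x0).
by apply; apply: open_nbhs_nbhs; split => //; exact: h.
Qed.

Lemma measurable_exit_point {R : realType} {n : nat} (Omega : set 'rV[R]_n)
    (i : 'I_n) (M : R) :
  open Omega -> (forall y, Omega y -> `|y 0 i| <= M) ->
  measurable_fun setT (exit_point Omega i).
Proof.
move=> oO OM.
rewrite (_ : exit_point Omega i =
    fun x => coord_affine i 1 (- exit_time Omega i x) x); last first.
  by apply/funext => x; rewrite /exit_point line_affine.
apply: measurable_coord_affine => //.
by apply: measurableT_comp => //; exact: measurable_exit_time oO OM.
Qed.

Lemma within_closed_preimage {R : realType} {n : nat} (A : set 'rV[R]_n)
    (g : 'rV[R]_n -> R) (B : set R) :
  closed A -> {within A, continuous g} -> closed B -> closed (A `&` g @^-1` B).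
Proof.
move=> cA cg cB.
have /closed_subspaceP[V cV VA] : closed (g @^-1` B : set (subspace A)).
  by move/continuous_closedP : cg; exact.
by rewrite setIC -VA; exact: closedI.
Qed.

Lemma within_continuous_measurable {R : realType} {n : nat} (A : set 'rV[R]_n)
    (g : 'rV[R]_n -> R) :
  closed A -> {within A, continuous g} -> measurable_fun A g.
Proof.
move=> cA cg; apply: (measurability _ (RGenCInfty.measurableE R)).
move=> _ [_ [c ->] <-]; apply: closed_measurable_rV.
by apply: within_closed_preimage => //; exact: interval_closed.
Qed.

Lemma hausdorff_closed_measurable {R : realType} {n : nat} (s : nat)
    (A : set 'rV[R]_n) : closed A ->
  measurable (A : set (caratheodory_space (@hausdorff_outer R n s))).
Proof. by apply: closed_caratheodory => B C r; exact: hausdorff_metric. Qed.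

Lemma within_continuous_hausdorff_measurable {R : realType} {n : nat} (s : nat)
    (A B : set 'rV[R]_n) (g : 'rV[R]_n -> R) :
  closed A -> closed B -> {within A, continuous g} -> B `<=` A ->
  measurable_fun (B : set (caratheodory_space (@hausdorff_outer R n s))) g.
Proof.
move=> cA cB cg BA; apply: (measurability _ (RGenCInfty.measurableE R)).
move=> _ [_ [c ->] <-]; apply: hausdorff_closed_measurable.
rewrite -(setIidl BA) -setIA; apply: closedI => //.
by apply: within_closed_preimage => //; exact: interval_closed.
Qed.

Lemma boundary_closed {R : realType} {n : nat} (Omega : set 'rV[R]_n) :
  closed (boundary Omega).
Proof.
apply: closedI; first exact: closed_closure.
by apply: open_closedC; exact: open_interior.
Qed.

(** The points of [Omega] that exit in [E] lie in the cylinder above [E], whose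
    volume [slab_le_hausdorff] bounds; so the image of Lebesgue measure under
    the exit map is at most [K] times surface measure. *)
Lemma exit_integral_le {R : realType} {n : nat} (Omega : set 'rV[R]_n)
    (i : 'I_n) (M : R) : 0 <= M ->
  open Omega -> (forall y, Omega y -> `|y 0 i| <= M) ->
  exists2 K : R, 0 < K & forall g : 'rV[R]_n -> R, (forall x, 0 <= g x) ->
    measurable_fun (closure Omega) g ->
    measurable_fun
      (boundary Omega : set (caratheodory_space (@hausdorff_outer R n n.-1))) g ->
    (\int[lebesgue_rV n]_(x in Omega) (g (exit_point Omega i x))%:E <=
     K%:E * \int[surface_measure n]_(x in boundary Omega) (g x)%:E)%E.
Proof.
move=> M0 oO OM; have [K K0 hK] := slab_le_hausdorff i M0.
exists K => // g g0 mg mgS.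
have bd x : Omega x -> boundary Omega (exit_point Omega i x).
  exact: exit_point_boundary oO OM.
have mO : measurable Omega by exact: open_measurable_rV.
have mgb : measurable_fun Omega (fun x => g (exit_point Omega i x)).
  apply: (measurable_comp (F := closure Omega)) => //.
  - by apply: closed_measurable_rV; exact: closed_closure.
  - by move=> _ [x Ox <-]; exact: (bd x Ox).1.
  - by apply: measurable_funTS; exact: measurable_exit_point oO OM.
apply: integral_le_distribution => //.
- by apply: hausdorff_closed_measurable; exact: boundary_closed.
- exact: ltW.
move=> A mA; apply: hK; first exact: mgb.
move=> x [Ox gA]; split; first exact: OM.
exists (exit_point Omega i x); first by split => //; exact: bd.
by move=> j /negbTE ji; rewrite line_coord ji addr0.
Qed.

(** * Differentiation along lines and averaging over coordinate maps *)

Lemma is_derive_line {R : realType} {n : nat} (i : 'I_n) (f : 'rV[R]_n -> R)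
    (x : 'rV[R]_n) (s : R) :
  derivable f (line i x s) (delta_mx 0 i) ->
  is_derive s 1 (fun t => f (line i x t)) (partial i f (line i x s)).
Proof.
move=> df.
have E : (fun h : R => h^-1 *: (((fun t => f (line i x t)) \o shift s) (h *: (1 : R))
      - f (line i x s))) =
    (fun h : R => h^-1 *: ((f \o shift (line i x s)) (h *: delta_mx 0 i)
      - f (line i x s))).
  apply/funext => h; congr (_ *: (f _ - _)) => /=.
  by rewrite /line [h *: 1]mulr1 scalerDl addrCA.
by split; rewrite /partial /derivable /derive E.
Qed.

Lemma is_derive_dilation {R : realType} {n : nat} (i : 'I_n)
    (f : 'rV[R]_n -> R) (x : 'rV[R]_n) (s : R) :
  derivable f (coord_affine i s 0 x) (delta_mx 0 i) ->
  is_derive s 1 (fun t => f (coord_affine i t 0 x))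
    (x 0 i * partial i f (coord_affine i s 0 x)).
Proof.
have E t : coord_affine i t 0 x = line i x (x 0 i * (t - 1)).
  by rewrite coord_affineE addr0 /line mulrC.
rewrite E => df; rewrite mulrC.
have -> : (fun t => f (coord_affine i t 0 x)) =
    (fun t => f (line i x t)) \o (fun t => x 0 i * (t - 1)).
  by apply/funext => t /=; rewrite E.
apply: is_derive1_comp; first exact: is_derive_line.
rewrite (_ : (fun t => _) = x 0 i \*: (@id R - cst 1)); last first.
  by apply/funext => t.
by apply: is_derive_eq; rewrite subr0 [_ *: _]mulr1.
Qed.

Lemma within_continuous_image {T U V : topologicalType} (A : set U) (B : set T)
    (g : U -> V) (f : T -> U) :
  {within A, continuous g} -> continuous f -> (forall x, B x -> A (f x)) ->
  {within B, continuous (g \o f)}.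
Proof.
move=> /subspace_continuousP cg cf BA; apply/subspace_continuousP => x Bx.
apply: cvg_comp (cg _ (BA _ Bx)) => W /cf fW.
have : \forall y \near x, A (f y) -> W (f y) by exact: fW.
rewrite /within /= => h; apply: filterS h => y h By; exact: h (BA _ By).
Qed.

Lemma measurable_coord_affine_family {R : realType} {n : nat} (i : 'I_n)
    (a b : R) (s c : R -> R) (F : 'rV[R]_n -> \bar R) :
  measurable_fun setT s -> measurable_fun setT c -> measurable_fun setT F ->
  measurable_fun setT (fun p : 'rV[R]_n * measurableTypeR R =>
    ((fun t => F (coord_affine i (s t) (c t) p.1)) \_ `[a, b]) p.2).
Proof.
move=> ms mc mF; pose H (p : 'rV[R]_n * measurableTypeR R) :=
  F (coord_affine i (s p.2) (c p.2) p.1).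
have mH : measurable_fun setT H.
  apply: (measurableT_comp mF); apply: measurable_coord_affine.
  - exact: measurableT_comp ms measurable_snd.
  - exact: measurableT_comp mc measurable_snd.
  - exact: measurable_fst.
pose I0 : set (measurableTypeR R) := `[a, b]%classic.
have mI0 : measurable I0 by exact: measurable_itv.
have mT : measurable ([set: 'rV[R]_n] `*` I0) by exact: measurableX.
rewrite (_ : (fun p => _) = H \_ ([set: 'rV[R]_n] `*` I0)); last first.
  apply/funext => -[x t]; rewrite !patchE; congr (if _ then _ else _).
  by apply/idP/idP => /set_mem h; apply/mem_set; [split|exact: h.2].
exact: (measurable_restrictT H mT).1 (measurable_funTS mH).
Qed.

Lemma measurable_integral_coord_affine_family {R : realType} {n : nat}
    (i : 'I_n) (a b : R) (s c : R -> R) (F : 'rV[R]_n -> \bar R) :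
  measurable_fun setT s -> measurable_fun setT c ->
  measurable_fun setT F -> (forall x, 0 <= F x)%E ->
  measurable_fun setT (fun x => \int[lebesgue_measure]_(t in `[a, b])
     F (coord_affine i (s t) (c t) x))%E.
Proof.
move=> ms mc mF F0.
rewrite (_ : (fun x => _) = (fun x => \int[lebesgue_measure]_t
    ((fun t => F (coord_affine i (s t) (c t) x)) \_ `[a, b]) t)%E); last first.
  by apply/funext => x; rewrite integral_mkcond.
apply: (measurable_fun_fubini_tonelli_F _
  (measurable_coord_affine_family i a b ms mc mF)).
by move=> p; apply: erestrict_ge0.
Qed.

(** Tonelli: for each [t] the coordinate map has Jacobian [s t >= 1], so the
    change of variables does not increase the integral of [F]. *)
Lemma integral_coord_affine_family {R : realType} {n : nat} (i : 'I_n)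
    (a b : R) (s c : R -> R) (F : 'rV[R]_n -> \bar R) :
  a <= b -> measurable_fun setT s -> measurable_fun setT c ->
  (forall t, a <= t <= b -> 1 <= s t) ->
  measurable_fun setT F -> (forall x, 0 <= F x)%E ->
  (\int[lebesgue_rV n]_x \int[lebesgue_measure]_(t in `[a, b])
     F (coord_affine i (s t) (c t) x) <=
   (b - a)%:E * \int[lebesgue_rV n]_x F x)%E.
Proof.
move=> ab ms mc s1 mF F0.
pose I0 : set (measurableTypeR R) := `[a, b]%classic.
have mI0 : measurable I0 by exact: measurable_itv.
have mH' := measurable_coord_affine_family i a b ms mc mF.
set H' := (fun p => _) in mH'.
have H'0 p : (0 <= H' p)%E by apply: erestrict_ge0.
have mF' t : measurable_fun setT (fun x => F (coord_affine i (s t) (c t) x)).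
  by apply: (measurableT_comp mF); apply: measurable_coord_affine.
rewrite (eq_integral (fun x => \int[lebesgue_measure]_t H' (x, t))%E); last first.
  by move=> x _; rewrite integral_mkcond.
rewrite (@fubini_tonelli _ _ _ _ R (lebesgue_rV n) lebesgue_measure H')//.
pose J t := (\int[lebesgue_rV n]_x F (coord_affine i (s t) (c t) x))%E.
have HJ : (fun t => \int[lebesgue_rV n]_x H' (x, t))%E = J \_ I0.
  apply/funext => t; rewrite patchE; case: ifPn => tI.
    by apply: eq_integral => x _; rewrite /H' patchE tI.
  by apply: integral0_eq => x _; rewrite /H' patchE (negbTE tI).
have mJ : measurable_fun I0 J.
  apply/(measurable_restrictT _ mI0); rewrite -HJ.
  exact: (measurable_fun_fubini_tonelli_G _ mH').
rewrite HJ -integral_mkcond.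
have -> : ((b - a)%:E * \int[lebesgue_rV n]_x F x =
    \int[lebesgue_measure]_(t in I0) cst (\int[lebesgue_rV n]_x F x) t)%E.
  rewrite integral_cst// muleC; congr (_ * _)%E.
  rewrite /I0 [RHS]lebesgue_measure_itv/= lte_fin; case: ltP => // ba.
  by rewrite (_ : b = a) ?subrr//; apply/eqP; rewrite eq_le ba.
apply: ge0_le_integral => //.
- by move=> t _; exact: integral_ge0.
- move=> t; rewrite /I0 /J /= in_itv/= => /s1 st.
  have st0 : 0 < s t by exact: lt_le_trans st.
  rewrite integral_coord_affine//; rewrite -[leRHS]mul1e.
  apply: lee_pmul => //; last by rewrite lee_fin invf_le1.
    by rewrite lee_fin invr_ge0 ltW.
  exact: integral_ge0.
Qed.

(** * The inequality for compactly supported fields *)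

Lemma measurable_abs_powR {R : realType} d (T : measurableType d) (D : set T)
    (f : T -> R) (p : R) :
  measurable_fun D f -> measurable_fun D (fun x => (`|f x| `^ p)%:E).
Proof.
move=> mf; apply/measurable_EFinP.
apply: (measurableT_comp (@measurable_powR R p)).
exact: measurableT_comp.
Qed.

Lemma ler_powR_base {R : realType} (p x y : R) : 0 <= p -> 0 <= x -> x <= y ->
  x `^ p <= y `^ p.
Proof.
by move=> p0 x0 xy; apply: ge0_ler_powR => //; rewrite nnegrE//; exact: le_trans xy.
Qed.

Lemma absorb_half {R : realType} (X Y : \bar R) : (X < +oo)%E -> (0 <= X)%E ->
  (X <= 2^-1%:E * X + Y)%E -> (X <= 2%:E * Y)%E.
Proof.
move: X Y => [x||]// [y||]//=; rewrite ?lee_fin.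
- by move=> _ x0 h; lra.
- by move=> _ _ _; rewrite gt0_muley ?leey// lte_fin.
Qed.

Lemma powR2_ge2 {R : realType} (p : R) : 1 <= p -> 2 <= 2 `^ p :> R.
Proof. by move=> p1; rewrite -[leLHS]powRr1// ler_powR// ler1n. Qed.

(** The curve [s |-> A_s x], where [A_s] multiplies the coordinate [i] by [s],
    joins [x] to [A_K x] with [K = 2 ^ p]. The derivative [x_i * D_i f (A_s x)]
    of [f] along it is at most the value of [y_i * D_i f y] at [y = A_s x] in
    absolute value, because [s >= 1]. *)
Lemma dilation_increment {R : realType} {n : nat} (p : R) (i : 'I_n)
    (f : 'rV[R]_n -> R) (x : 'rV[R]_n) : 1 <= p ->
  (forall y, {for y, continuous f}) ->
  (forall y, derivable f y (delta_mx 0 i)) ->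
  (forall y, {for y, continuous (partial i f)}) ->
  ((`|f x| `^ p)%:E <= (2 `^ (p - 1))%:E *
     ((`|f (coord_affine i (2 `^ p) 0 x)| `^ p)%:E +
      ((2 `^ p - 1) `^ (p - 1))%:E * \int[lebesgue_measure]_(s in `[1%R, (2 `^ p)%R])
        (`|(coord_affine i s 0 x) 0 i * partial i f (coord_affine i s 0 x)| `^ p)%:E))%E.
Proof.
move=> p1 cf df cpf; set K := 2 `^ p.
have K2 : 2 <= K by exact: powR2_ge2.
have K1 : 1 < K by lra.
have cA : continuous (fun s => coord_affine i s 0 x).
  move=> s; rewrite (_ : (fun s => _) = fun s => line i x (x 0 i * (s - 1))); last first.
    by apply/funext => t; rewrite coord_affineE addr0 /line mulrC.
  have c1 : {for s, continuous (fun s : R => x 0 i * (s - 1))}.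
    apply: cvgM; first exact: cvg_cst.
    by apply: cvgB; [exact: cvg_id|exact: cvg_cst].
  exact: continuous_comp c1 (@line_continuous _ _ i x _).
pose h s := f (coord_affine i s 0 x).
pose k s := x 0 i * partial i f (coord_affine i s 0 x).
have ch : continuous h by move=> s; apply: continuous_comp; [exact: cA|exact: cf].
have ck : continuous k.
  move=> s; apply: cvgM; first exact: cvg_cst.
  by apply: continuous_comp; [exact: cA|exact: cpf].
have dh (s : R) : is_derive s 1 h (k s) by exact: is_derive_dilation.
have incr := @increment_powR R p 1 K h k p1 K1 (continuous_subspaceT ck) _ _.
have {incr} : ((`|h K - h 1| `^ p)%:E <= ((K - 1) `^ (p - 1))%:E *
     \int[lebesgue_measure]_(s in `[1%R, K]) (`|k s| `^ p)%:E)%E.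
  apply: incr; last by move=> s _; rewrite derive1E; apply: derive_val.
  split; last 2 first.
  - by apply: cvg_at_right_filter; exact: ch.
  - by apply: cvg_at_left_filter; exact: ch.
  by move=> s _; exact: ex_derive.
have -> : h 1 = f x.
  by rewrite /h coord_affineE subrr mul0r addr0 scale0r addr0.
move=> incr.
apply: (@le_trans _ _ ((2 `^ (p - 1))%:E *
  ((`|h K| `^ p)%:E + (`|h K - f x| `^ p)%:E))%E).
  rewrite -EFinD -EFinM lee_fin; apply: le_trans (powR_add_le p1 _ _) => //.
  apply: ler_powR_base => //; first by lra.
  rewrite (_ : f x = h K - (h K - f x)); last by rewrite subKr.
  by rewrite [X in _ <= _ + `|_ - X|]subKr; exact: ler_normB.
apply: lee_pmul => //; first by rewrite adde_ge0.
apply: leeD; first exact: lexx.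
apply: (le_trans incr); apply: lee_pmul.
- by rewrite lee_fin powR_ge0.
- exact: integral_ge0.
- exact: lexx.
have mk : measurable_fun setT k by exact: continuous_measurable_fun.
apply: ge0_le_integral => //.
- by apply: measurable_funTS; exact: measurable_abs_powR.
- apply: measurable_funTS; apply: measurable_abs_powR.
  rewrite (_ : (fun s => _) = (fun s => (s * x 0 i) * partial i f (coord_affine i s 0 x))).
    apply: continuous_measurable_fun => s; apply: cvgM.
      by apply: cvgM; [exact: cvg_id|exact: cvg_cst].
    by apply: continuous_comp; [exact: cA|exact: cpf].
  by apply/funext => s; rewrite mxE eqxx addr0.
move=> s; rewrite /= in_itv/= => /andP[s1 _].
rewrite lee_fin; apply: ler_powR_base => //; first by lra.
rewrite /k mxE eqxx addr0 !normrM -mulrA ler_peMl//.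
by rewrite ger0_norm//; lra.
Qed.

(** The dilation by [K = 2 ^ p] divides the integral of [|f|^p] by [K], which
    beats the convexity constant [2 ^ (p - 1)] by a factor 2. *)
Lemma hardy_coordinate {R : realType} {n : nat} (p M : R) (i : 'I_n)
    (f : 'rV[R]_n -> R) : 1 <= p ->
  (forall y, {for y, continuous f}) ->
  (forall y, derivable f y (delta_mx 0 i)) ->
  (forall y, {for y, continuous (partial i f)}) ->
  (forall y, M < `|y| -> f y = 0) ->
  (\int[lebesgue_rV n]_x (`|f x| `^ p)%:E <=
   (2 `^ p * (2 `^ p - 1) `^ p)%:E *
     \int[lebesgue_rV n]_x (`|x 0 i * partial i f x| `^ p)%:E)%E.
Proof.
move=> p1 cf df cpf f0; set K := 2 `^ p.
have K2 : 2 <= K by exact: powR2_ge2.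
have K1 : 1 < K by lra.
have p0 : 0 <= p by lra.
have mf : measurable_fun setT f by apply: continuous_open_measurable_rV => //; exact: openT.
have mpf : measurable_fun setT (partial i f).
  by apply: continuous_open_measurable_rV => //; exact: openT.
pose G (y : 'rV[R]_n) := (`|y 0 i * partial i f y| `^ p)%:E.
have mG : measurable_fun setT G.
  by apply: measurable_abs_powR; apply: measurable_funM => //; exact: measurable_coord.
have G0 y : (0 <= G y)%E by rewrite lee_fin powR_ge0.
have mfp : measurable_fun setT (fun x => (`|f x| `^ p)%:E) by exact: measurable_abs_powR.
set X := (\int[_]_x (`|f x| `^ p)%:E)%E.
have X0 : (0 <= X)%E by apply: integral_ge0 => x _; rewrite lee_fin powR_ge0.
(* [f] is bounded and vanishes off a cube, so the term can be absorbed *)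
have Xfin : (X < +oo)%E.
  pose r : 'I_n -> R := fun=> `|M|.
  have [mB muB] := @lebesgue_rV_box R n 0 r (fun=> normr_ge0 M).
  set B := [set x | _] in mB muB.
  have fB y : ~ B y -> f y = 0.
    move=> nB; apply: f0; rewrite ltNge; apply/negP => yM; apply: nB => j.
    rewrite mxE subr0; apply: (le_trans (rV_coord_le_norm y j)).
    exact: le_trans yM (ler_norm M).
  have [b hb] : exists b, forall y, `|f y| <= b.
    have cB : compact B.
      rewrite (_ : B = [set v : 'rV[R]_n | forall j, v 0 j \in `[- `|M|, `|M|]]).
        apply: (@rV_compact _ _ (fun=> `[- `|M|, `|M|]%classic)) => _.
        exact: segment_compact.
      by apply/seteqP; split => v /= h j; have := h j; rewrite mxE subr0 in_itv/= ler_norml.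
    have B0 : B !=set0 by exists 0 => j; rewrite mxE subrr normr0 normr_ge0.
    have cfB : {within B, continuous (fun y => `|f y|)}.
      apply: continuous_subspaceT => y.
      by apply: continuous_comp; [exact: cf|exact: norm_continuous].
    have [c _ hc] := EVT_max_rV B0 cB cfB.
    exists `|f c| => y; have [By|nBy] := pselect (B y); first by apply: hc; rewrite inE.
    by rewrite (fB _ nBy) normr0.
  apply: (@le_lt_trans _ _ (\int[lebesgue_rV n]_(x in B) cst (b `^ p)%:E x)%E); last first.
    by rewrite integral_cst// [X in (_ * X)%E]muB -EFinM ltry.
  rewrite [leRHS]integral_mkcond; apply: ge0_le_integral => //.
  - exact: (measurable_restrictT _ mB).1.
  move=> y _; rewrite patchE; case: ifPn => yB.
    by rewrite lee_fin; apply: ler_powR_base.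
  rewrite fB ?normr0 ?powR0//; first by apply: lt0r_neq0; lra.
  by move: yB; rewrite notin_setE.
have step : (X <= (2 `^ (p - 1))%:E * (K^-1%:E * X +
    ((K - 1) `^ (p - 1))%:E * ((K - 1)%:E * \int[lebesgue_rV n]_x G x)))%E.
  have mA : measurable_fun setT (fun x => (`|f (coord_affine i K 0 x)| `^ p)%:E).
    by apply: (measurableT_comp mfp); apply: measurable_coord_affine.
  have mI : measurable_fun setT (fun x => \int[lebesgue_measure]_(s in `[1%R, K])
      G (coord_affine i s 0%R x))%E.
    apply: (@measurable_integral_coord_affine_family R n i 1 K id (cst 0) G) => //.
  have I0 x : (0 <= \int[lebesgue_measure]_(s in `[1%R, K]) G (coord_affine i s 0%R x))%E.
    by apply: integral_ge0.
  apply: (@le_trans _ _ (\int[lebesgue_rV n]_x ((2 `^ (p - 1))%:E *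
     ((`|f (coord_affine i K 0 x)| `^ p)%:E +
      ((K - 1) `^ (p - 1))%:E * \int[lebesgue_measure]_(s in `[1%R, K])
        G (coord_affine i s 0%R x))))%E).
    apply: ge0_le_integral => //.
    - by apply: emeasurable_funM => //; apply: emeasurable_funD => //; exact: emeasurable_funM.
    - by move=> x _; exact: dilation_increment.
  rewrite ge0_integralZl_EFin ?powR_ge0//; last 2 first.
  - by move=> x _; rewrite adde_ge0// ?lee_fin ?powR_ge0// mule_ge0// lee_fin powR_ge0.
  - by apply: emeasurable_funD => //; exact: emeasurable_funM.
  rewrite ge0_integralD//; last 2 first.
  - by move=> x _; rewrite mule_ge0// lee_fin powR_ge0.
  - exact: emeasurable_funM.
  apply: lee_pmul => //.
    by apply: adde_ge0; apply: integral_ge0 => x _; rewrite ?mule_ge0 ?I0 ?lee_fin ?powR_ge0.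
  apply: leeD.
    rewrite (integral_coord_affine i 0 (G := fun x => (`|f x| `^ p)%:E))//; lra.
  rewrite ge0_integralZl_EFin ?powR_ge0//.
  apply: lee_pmul => //; first by rewrite lee_fin powR_ge0.
    by apply: integral_ge0.
  apply: (@integral_coord_affine_family R n i 1 K id (cst 0)) => //; first exact: ltW.
  by move=> t /andP[].
apply: (@le_trans _ _ (2%:E * ((2 `^ (p - 1))%:E * (((K - 1) `^ (p - 1))%:E *
    ((K - 1)%:E * \int[lebesgue_rV n]_x G x))))%E).
  apply: absorb_half => //; apply: (le_trans step).
  rewrite ge0_muleDr; last 2 first.
  - by rewrite mule_ge0// lee_fin invr_ge0; lra.
  - by rewrite !mule_ge0 ?lee_fin ?powR_ge0 ?integral_ge0//; lra.
  rewrite leeD2r// muleA -EFinM.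
  rewrite (_ : 2 `^ (p - 1) * K^-1 = 2^-1)//.
  by rewrite /K -(@powR_predM _ p 2)//; field; rewrite gt_eqF// powR_gt0.
have K10 : 0 <= K - 1 by lra.
rewrite !muleA -!EFinM [2 * _]mulrC (powR_predM p1 (ler0n _ 2)).
by rewrite -mulrA (powR_predM p1 K10).
Qed.

Lemma integral_frobenius_le {R : realType} {n : nat} (p : R)
    (D : set 'rV[R]_n) (u : 'rV[R]_n -> 'rV[R]_n) :
  1 <= p -> (0 < n)%N -> measurable D ->
  (forall j, measurable_fun D (fun x => u x 0 j)) ->
  (\int[lebesgue_rV n]_(x in D) (frobenius (u x) `^ p)%:E <=
   (n%:R `^ (p - 1))%:E *
     \sum_(i < n) \int[lebesgue_rV n]_(x in D) (`|u x 0 i| `^ p)%:E)%E.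
Proof.
move=> p1 n0 mD mu.
have mui i : measurable_fun D (fun x => (`|u x 0 i| `^ p)%:E).
  exact: measurable_abs_powR.
rewrite -ge0_integral_sum//.
rewrite -ge0_integralZl_EFin ?powR_ge0//; last 2 first.
- by move=> x _; apply: sume_ge0.
- exact: emeasurable_sum.
apply: ge0_le_integral => //.
- by move=> x _; rewrite lee_fin powR_ge0.
- apply/measurable_EFinP; apply: (measurableT_comp (@measurable_powR R p)).
  by apply: measurable_frobenius => i j; rewrite ord1.
- by apply: emeasurable_funM => //; exact: emeasurable_sum.
- by move=> x _; rewrite sumEFin -EFinM lee_fin; exact: frobenius_powR_le.
Qed.

Lemma sym_gradient_diag {R : realType} {n : nat} (u : 'rV[R]_n -> 'rV[R]_n)
    (x : 'rV[R]_n) (i : 'I_n) :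
  sym_gradient u x i i = partial i (fun y => u y 0 i) x.
Proof. by rewrite !mxE; field. Qed.

Lemma measurable_sym_gradient {R : realType} {n : nat} (D : set 'rV[R]_n)
    (u : 'rV[R]_n -> 'rV[R]_n) (p : R) :
  open D -> (forall j, smooth_on D (fun x => u x 0 j)) ->
  measurable_fun D (fun x => frobenius (sym_gradient u x) `^ p).
Proof.
move=> oD su; apply: (measurableT_comp (@measurable_powR R p)).
have mp i j : measurable_fun D (partial i (fun y => u y 0 j)).
  by apply: continuous_open_measurable_rV => // x Dx; exact: (su j [:: i] x Dx).1.
apply: measurable_frobenius => i j.
rewrite (_ : (fun x => _) = fun x =>
  2^-1 * (partial i (fun y => u y 0 j) x + partial j (fun y => u y 0 i) x)).
  by apply: measurable_funM => //; exact: measurable_funD.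
by apply/funext => x; rewrite !mxE.
Qed.

Lemma hardy_sym_gradient {R : realType} (N : nat) (p : R) :
  (0 < N)%N -> 1 <= p ->
  exists C : R, 0 < C /\
    forall Omega : set 'rV[R]_N, open Omega ->
    forall u : 'rV[R]_N -> 'rV[R]_N, smooth_compactly_supported Omega u ->
      (\int[lebesgue_rV N]_(x in Omega) (frobenius (u x) `^ p)%:E <=
       (C `^ p)%:E * \int[lebesgue_rV N]_(x in Omega)
         (frobenius x `^ p * frobenius (sym_gradient u x) `^ p)%:E)%E.
Proof.
move=> N0 p1; have p0 : 0 < p by lra.
pose c : R := 2 `^ p * (2 `^ p - 1) `^ p.
have c0 : 0 < c.
  by rewrite mulr_gt0 ?powR_gt0// subr_gt0; have := powR2_ge2 p1; lra.
pose C : R := N%:R `^ (p - 1) * (N%:R * c).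
have NR : 0 < N%:R :> R by rewrite ltr0n.
have C0 : 0 < C by apply: mulr_gt0; [exact: powR_gt0|exact: mulr_gt0].
exists (C `^ p^-1); split; first by rewrite powR_gt0.
move=> Omega oO u [su csupp suppO].
rewrite -powRrM mulVf ?gt_eqF// powRr1; last exact: ltW.
have mO : measurable Omega by exact: open_measurable_rV.
set g := fun x => (frobenius x `^ p * frobenius (sym_gradient u x) `^ p)%:E.
have cu j y : {for y, continuous (fun x => u x 0 j)} by exact: (su j [::] y I).1.
have du j i y : derivable (fun x => u x 0 j) y (delta_mx 0 i).
  exact: (su j [::] y I).2.
have cpu j i y : {for y, continuous (partial i (fun x => u x 0 j))}.
  exact: (su j [:: i] y I).1.
have mu j : measurable_fun setT (fun x => u x 0 j).
  by apply: continuous_open_measurable_rV => //; exact: openT.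
have g0 x : (0 <= g x)%E by rewrite lee_fin mulr_ge0 ?powR_ge0.
have mg : measurable_fun setT g.
  apply/measurable_EFinP; apply: measurable_funM.
    apply: (measurableT_comp (@measurable_powR R p)).
    by apply: measurable_frobenius => i j; rewrite ord1; exact: measurable_coord.
  by apply: measurable_sym_gradient => //; exact: openT.
(* outside [Omega] the field vanishes near [x], hence so does its gradient *)
have gE : (\int[lebesgue_rV N]_(x in Omega) g x = \int[lebesgue_rV N]_x g x)%E.
  rewrite integral_mkcond; apply: eq_integral => x _; rewrite patchE.
  case: ifPn => // xO; rewrite /g.
  have u0 : \forall y \near x, u y = 0.
    have xs : (~` closure [set x | u x != 0]) x.
      by move=> /suppO Ox; move: xO; rewrite notin_setE.
    have : nbhs x (~` closure [set x | u x != 0]).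
      apply: open_nbhs_nbhs; split => //; apply: closed_openC.
      exact: closed_closure.
    apply: filterS => y ys; apply/eqP; apply: contrapT => /negP uy.
    by apply: ys; apply: subset_closure.
  have grad0 i j : partial i (fun y => u y 0 j) x = 0.
    rewrite /partial (@near_eq_derive _ _ _ _ (cst 0)).
      by rewrite derive_cst.
    by apply: filterS u0 => y ->; rewrite mxE.
  have -> : sym_gradient u x = 0.
    by apply/matrixP => i j; rewrite !mxE !grad0 addr0 mulr0.
  have -> : frobenius (0 : 'M[R]_N) = 0.
    rewrite /frobenius big1 ?sqrtr0// => i _; rewrite big1// => j _.
    by rewrite mxE expr0n.
  by rewrite powR0 ?mulr0// gt_eqF.
rewrite gE.
have [M Mu] : exists M : R, forall y, M < `|y| -> u y = 0.
  have /pinfty_ex_gt0[M _ hM] := compact_bounded csupp.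
  exists M => y My; apply/eqP; apply: contrapT => /negP uy.
  have yS : closure [set x | u x != 0] y by exact: subset_closure.
  by have := hM y yS; rewrite /= leNgt My.
apply: (@le_trans _ _ (\int[lebesgue_rV N]_x (frobenius (u x) `^ p)%:E)%E).
  apply: ge0_subset_integral => //; last by move=> x _; rewrite lee_fin powR_ge0.
  apply/measurable_EFinP; apply: (measurableT_comp (@measurable_powR R p)).
  by apply: measurable_frobenius => i j; rewrite ord1.
apply: (le_trans (integral_frobenius_le p1 N0 measurableT mu)).
rewrite /C EFinM -muleA; apply: lee_pmul => //.
  by apply: sume_ge0 => i _; exact: integral_ge0.
apply: (@le_trans _ _ (\sum_(i < N) (c%:E * \int[lebesgue_rV N]_x g x))%E).
  apply: lee_sum => i _.
  apply: (le_trans (@hardy_coordinate R N p M i (fun x => u x 0 i) p1 _ _ _ _)) => //.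
    by move=> y /Mu ->; rewrite mxE.
  apply: lee_pmul => //; [by rewrite lee_fin ltW|exact: integral_ge0|].
  apply: ge0_le_integral => //.
    apply: measurable_abs_powR; apply: measurable_funM; first exact: measurable_coord.
    by apply: continuous_open_measurable_rV => //; exact: openT.
  move=> x _; rewrite lee_fin normrM powRM//.
  apply: ler_pM; rewrite ?powR_ge0//; apply: ler_powR_base => //; try exact: ltW.
    exact: abs_le_frobenius.
  by rewrite -sym_gradient_diag; exact: abs_le_frobenius.
by rewrite sumr_const card_ord (EFinM N%:R c) -[leRHS]muleA mule_natl.
Qed.

Lemma korn_compact_support {R : realType} (N : nat) (p : R) :
  (0 < N)%N -> 1 <= p ->
  forall Omega : set 'rV[R]_N, open Omega -> bounded_set Omega ->
    exists kappa : R, 0 < kappa /\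
    forall u : 'rV[R]_N -> 'rV[R]_N, smooth_compactly_supported Omega u ->
      (\int[lebesgue_rV N]_(x in Omega) (frobenius (u x) `^ p)%:E <=
       (kappa `^ p)%:E * \int[lebesgue_rV N]_(x in Omega)
         (frobenius (sym_gradient u x) `^ p)%:E)%E.
Proof.
move=> N0 p1 Omega oO bO; have [C [C0 hC]] := hardy_sym_gradient N0 p1.
have [M M0 hM] := pinfty_ex_gt0 bO.
pose B : R := N%:R * M.
have B0 : 0 < B by rewrite mulr_gt0// ltr0n.
have frB x : Omega x -> frobenius x <= B.
  move=> Ox; apply: (le_trans (frobenius_le_sum x)).
  apply: (@le_trans _ _ (\sum_(i < N) M)).
    by apply: ler_sum => i _; exact: le_trans (rV_coord_le_norm x i) (hM x Ox).
  by rewrite sumr_const card_ord -mulr_natl.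
exists (C * B); split; first exact: mulr_gt0.
move=> u su; apply: (le_trans (hC Omega oO u su)).
have mO : measurable Omega by exact: open_measurable_rV.
have me : measurable_fun Omega (fun x => frobenius (sym_gradient u x) `^ p).
  case: su => su _ _; apply: measurable_sym_gradient => // j s x _.
  exact: su.
rewrite (powRM _ (ltW C0) (ltW B0)) EFinM -muleA; apply: lee_pmul => //.
- by rewrite lee_fin powR_ge0.
- by apply: integral_ge0 => x _; rewrite lee_fin mulr_ge0// powR_ge0.
rewrite -(ge0_integralZl_EFin (lebesgue_rV N) mO); last 3 first.
- by move=> x _; rewrite lee_fin powR_ge0.
- exact/measurable_EFinP.
- exact: powR_ge0.
apply: ge0_le_integral => //.
- by move=> x _; rewrite lee_fin mulr_ge0// powR_ge0.
- apply/measurable_EFinP; apply: measurable_funM => //.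
  apply: (measurableT_comp (@measurable_powR R p)).
  by apply: measurable_frobenius => i j; rewrite ord1; apply: measurable_funTS; exact: measurable_coord.
- by apply: emeasurable_funM => //; exact/measurable_EFinP.
move=> x Ox; rewrite -EFinM lee_fin ler_wpM2r ?powR_ge0//.
by apply: ler_powR_base; [lra|exact: frobenius_ge0|exact: frB].
Qed.

(** * The inequality up to the boundary *)

(** [g] extends the partial derivative to the closure: the segment from [x] to
    its exit point is closed and ends on the boundary, where [f] need not be
    differentiable. The segment lies in [Omega], so the integral along it is
    at most the integral of the extension by zero over the maximal length
    [2 * M + 1]. *)
Lemma exit_increment {R : realType} {n : nat} (p M : R) (i : 'I_n)
    (Omega : set 'rV[R]_n) (f g : 'rV[R]_n -> R) (x : 'rV[R]_n) :
  1 <= p -> open Omega -> (forall y, Omega y -> `|y 0 i| <= M) ->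
  (forall y, Omega y -> derivable f y (delta_mx 0 i)) ->
  measurable_fun Omega (partial i f) ->
  {within closure Omega, continuous f} -> {within closure Omega, continuous g} ->
  (forall y, Omega y -> g y = partial i f y) -> Omega x ->
  ((`|f x| `^ p)%:E <= (2 `^ (p - 1))%:E *
     ((`|f (exit_point Omega i x)| `^ p)%:E +
      ((2 * M + 1) `^ (p - 1))%:E *
        \int[lebesgue_measure]_(s in `[(- (2 * M + 1))%R, 0%R])
          ((fun y => (`|partial i f y| `^ p)%:E) \_ Omega)
            (coord_affine i 1 s x)))%E.
Proof.
move=> p1 oO OM df mpf cf cg gE Ox; have p0 : 0 <= p by lra.
set L := 2 * M + 1; set t := exit_time Omega i x.
have t0 : 0 < t by exact: exit_time_gt0 oO OM Ox.
have tL : t <= L by exact: exit_time_le.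
have nt0 : - t < 0 by lra.
have inO s : - t < s -> s <= 0 -> Omega (line i x s).
  move=> ts s0; have [_ _ h] := exit_timeP x oO OM.
  by rewrite -[s]opprK; apply: h; rewrite ?oppr_ge0// ltrNl.
have incl s : s \in `[- t, 0] -> closure Omega (line i x s).
  rewrite in_itv/= => /andP[]; rewrite le_eqVlt => /orP[/eqP <- _|ts s0].
    exact: (exit_point_boundary oO OM Ox).1.
  by apply: subset_closure; exact: inO.
pose h s := f (line i x s); pose k s := g (line i x s).
have ch : {within `[- t, 0], continuous h}.
  by apply: within_continuous_image cf (@line_continuous _ _ i x) _ => s; exact: incl.
have ck : {within `[- t, 0], continuous k}.
  by apply: within_continuous_image cg (@line_continuous _ _ i x) _ => s; exact: incl.
have dh s : s \in `]- t, 0[ -> is_derive s 1 h (k s).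
  rewrite in_itv/= => /andP[ts s0].
  have Os : Omega (line i x s) by apply: inO => //; exact: ltW.
  by rewrite /k gE//; apply: is_derive_line; exact: df.
have incr : ((`|h 0 - h (- t)| `^ p)%:E <= ((0 - - t) `^ (p - 1))%:E *
     \int[lebesgue_measure]_(s in `[(- t)%R, 0%R]) (`|k s| `^ p)%:E)%E.
  apply: increment_powR => //.
    have [_ h1 h2] := (continuous_within_itvP h nt0).1 ch.
    by split => // s /dh ds; exact: ex_derive.
  by move=> s /dh ds; rewrite derive1E; apply: derive_val.
have h0 : h 0 = f x by rewrite /h /line scale0r addr0.
have mO : measurable Omega by exact: open_measurable_rV.
set F := (fun y => (`|partial i f y| `^ p)%:E) \_ Omega.
have mF : measurable_fun setT F.
  by apply/(measurable_restrictT _ mO); exact: measurable_abs_powR.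
have F0 y : (0 <= F y)%E by apply: erestrict_ge0.
have mFl : measurable_fun setT (fun s : measurableTypeR R => F (coord_affine i 1 s x)).
  by apply: (measurableT_comp mF); apply: measurable_coord_affine.
have mk : measurable_fun `]- t, 0] (fun s => (`|k s| `^ p)%:E).
  apply: measurable_abs_powR; apply: (@measurable_funS _ _ _ _ `[- t, 0]) => //.
    exact: subset_itv_oc_cc.
  exact: subspace_continuous_measurable_fun.
have int_le : (\int[lebesgue_measure]_(s in `[(- t)%R, 0%R]) (`|k s| `^ p)%:E <=
    \int[lebesgue_measure]_(s in `[(- L)%R, 0%R]) F (coord_affine i 1 s x))%E.
  rewrite -integral_itv_obnd_cbnd//.
  rewrite (eq_integral (fun s : measurableTypeR R => F (coord_affine i 1 s x))); last first.
    move=> s; rewrite inE /= in_itv/= => /andP[ts s0].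
    have Os := inO s ts s0.
    by rewrite -line_affine /F patchE mem_set// /k gE.
  have mI1 : measurable (`]- t, 0]%classic : set (measurableTypeR R)).
    exact: measurable_itv.
  have mI2 : measurable (`[- L, 0]%classic : set (measurableTypeR R)).
    exact: measurable_itv.
  apply: (ge0_subset_integral _ mI1 mI2).
  - exact: measurable_funTS.
  - by move=> s _; exact: F0.
  move=> s; rewrite /= !in_itv/= => /andP[ts ->]; rewrite andbT.
  by apply: ltW; apply: le_lt_trans ts; lra.
apply: (@le_trans _ _ ((2 `^ (p - 1))%:E *
  ((`|h (- t)| `^ p)%:E + (`|h 0 - h (- t)| `^ p)%:E))%E).
  rewrite -EFinD -EFinM lee_fin; apply: le_trans (powR_add_le p1 _ _) => //.
  apply: ler_powR_base => //; rewrite -h0.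
  by rewrite -[X in `|X| <= _](subrK (h (- t))) addrC; exact: ler_normD.
apply: lee_pmul => //; first by rewrite adde_ge0.
apply: leeD; first exact: lexx.
apply: (le_trans incr).
apply: lee_pmul => //.
- by rewrite lee_fin powR_ge0.
- exact: integral_ge0.
by rewrite sub0r opprK lee_fin; apply: ler_powR_base; lra.
Qed.

(** Integrate [exit_increment] over [Omega]: the exit value is handled by
    [exit_integral_le], the integral along the segment by translation
    invariance. *)
Lemma exit_coordinate {R : realType} {n : nat} (p M : R) (i : 'I_n)
    (Omega : set 'rV[R]_n) : 1 <= p -> open Omega ->
  (forall y, Omega y -> `|y 0 i| <= M) -> 0 <= M ->
  exists a b : R, [/\ 0 < a, 0 < b & forall (f g : 'rV[R]_n -> R),
  (forall y, Omega y -> derivable f y (delta_mx 0 i)) ->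
  measurable_fun Omega (partial i f) ->
  {within closure Omega, continuous f} -> {within closure Omega, continuous g} ->
  (forall y, Omega y -> g y = partial i f y) ->
  (\int[lebesgue_rV n]_(x in Omega) (`|f x| `^ p)%:E <=
   a%:E * \int[lebesgue_rV n]_(x in Omega) (`|partial i f x| `^ p)%:E +
   b%:E * \int[surface_measure n]_(x in boundary Omega) (`|f x| `^ p)%:E)%E].
Proof.
move=> p1 oO OM M0; have [K K0 hK] := exit_integral_le M0 oO OM.
set L := 2 * M + 1; have L0 : 0 < L by rewrite /L; lra.
exists (2 `^ (p - 1) * (L `^ (p - 1) * L)), (2 `^ (p - 1) * K).
split; [by rewrite !mulr_gt0 ?powR_gt0|by rewrite mulr_gt0 ?powR_gt0|].
move=> f g df mpf cf cg gE.
have mO : measurable Omega by exact: open_measurable_rV.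
have cC : closed (closure Omega) by exact: closed_closure.
have mf : measurable_fun (closure Omega) f by exact: within_continuous_measurable.
have mfO : measurable_fun Omega f.
  apply: measurable_funS mf; first exact: closed_measurable_rV.
  exact: subset_closure.
set F := (fun y => (`|partial i f y| `^ p)%:E) \_ Omega.
have mF : measurable_fun setT F.
  by apply/(measurable_restrictT _ mO); exact: measurable_abs_powR.
have F0 y : (0 <= F y)%E by apply: erestrict_ge0.
pose A x := (\int[lebesgue_measure]_(s in `[(- L)%R, 0%R]) F (coord_affine i 1 s x))%E.
have mA : measurable_fun setT A.
  exact: (@measurable_integral_coord_affine_family R n i (- L) 0 (cst 1) id F).
have A0 x : (0 <= A x)%E by apply: integral_ge0.
pose G (x : 'rV[R]_n) := `|f x| `^ p.
have mG : measurable_fun (closure Omega) G.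
  by apply/measurable_EFinP; exact: measurable_abs_powR.
have bd x : Omega x -> boundary Omega (exit_point Omega i x).
  exact: exit_point_boundary oO OM.
have mGb : measurable_fun Omega (fun x => (G (exit_point Omega i x))%:E).
  apply/measurable_EFinP; apply: (measurable_comp (F := closure Omega)) => //.
  - exact: closed_measurable_rV.
  - by move=> _ [x Ox <-]; exact: (bd x Ox).1.
  - by apply: measurable_funTS; exact: measurable_exit_point oO OM.
have G0 x : 0 <= G x by exact: powR_ge0.
have hG := hK G G0 mG _.
have {}hG : (\int[lebesgue_rV n]_(x in Omega) (G (exit_point Omega i x))%:E <=
     K%:E * \int[surface_measure n]_(x in boundary Omega) (G x)%:E)%E.
  apply: hG; apply/measurable_EFinP; apply: measurable_abs_powR.
  apply: within_continuous_hausdorff_measurable cf _ => //.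
    exact: boundary_closed.
  by move=> x [].
have mAO : measurable_fun Omega A by exact: measurable_funTS.
apply: (@le_trans _ _ (\int[lebesgue_rV n]_(x in Omega) ((2 `^ (p - 1))%:E *
   ((G (exit_point Omega i x))%:E + (L `^ (p - 1))%:E * A x)))%E).
  apply: ge0_le_integral => //.
  - exact: measurable_abs_powR.
  - apply: emeasurable_funM => //; apply: emeasurable_funD => //.
    exact: emeasurable_funM.
  - by move=> x Ox; exact: exit_increment cf cg gE Ox.
rewrite ge0_integralZl_EFin ?powR_ge0//; last 2 first.
- by move=> x _; rewrite adde_ge0 ?lee_fin// mule_ge0// lee_fin powR_ge0.
- by apply: emeasurable_funD => //; exact: emeasurable_funM.
rewrite ge0_integralD//; last 3 first.
- by move=> x _; rewrite lee_fin.
- by move=> x _; rewrite mule_ge0// lee_fin powR_ge0.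
- exact: emeasurable_funM.
rewrite ge0_integralZl_EFin ?powR_ge0//.
have hA : (\int[lebesgue_rV n]_(x in Omega) A x <=
    L%:E * \int[lebesgue_rV n]_(x in Omega) (`|partial i f x| `^ p)%:E)%E.
  apply: (@le_trans _ _ (\int[lebesgue_rV n]_x A x)%E).
    exact: ge0_subset_integral.
  rewrite [X in (_ <= _ * X)%E]integral_mkcond.
  have := @integral_coord_affine_family R n i (- L) 0 (cst 1) id F.
  rewrite sub0r opprK; apply => //; lra.
rewrite ge0_muleDr; last 2 first.
- by apply: integral_ge0 => x _; rewrite lee_fin.
- by rewrite mule_ge0 ?lee_fin ?powR_ge0// integral_ge0.
rewrite addeC; apply: leeD.
  rewrite [(2 `^ (p - 1) * (_ * _))%:E]EFinM [(L `^ _ * _)%:E]EFinM -!muleA.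
  apply: lee_pmul => //.
  - by rewrite mule_ge0 ?lee_fin ?powR_ge0// integral_ge0.
  apply: lee_pmul => //.
  - by rewrite lee_fin powR_ge0.
  - by rewrite integral_ge0.
rewrite EFinM -muleA; apply: lee_pmul => //.
by apply: integral_ge0 => x _; rewrite lee_fin.
Qed.

Lemma within_continuous_coord {R : realType} {n : nat} (A : set 'rV[R]_n)
    (u : 'rV[R]_n -> 'rV[R]_n) (j : 'I_n) :
  {within A, continuous u} -> {within A, continuous (fun x => u x 0 j)}.
Proof.
move=> cu; apply: (@within_continuous_comp _ _ _ A u (fun y => y 0 j)) => // y _.
exact: coord_continuous.
Qed.

Lemma korn_trace {R : realType} (N : nat) (p : R) (Omega : set 'rV[R]_N) :
  (0 < N)%N -> 1 <= p -> open Omega -> bounded_set Omega ->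
    exists kappa kappa_bd : R, [/\ 0 < kappa, 0 < kappa_bd &
    forall u : 'rV[R]_N -> 'rV[R]_N, smooth_up_to_boundary Omega u ->
      (\int[lebesgue_rV N]_(x in Omega) (frobenius (u x) `^ p)%:E <=
       (kappa `^ p)%:E * \int[lebesgue_rV N]_(x in Omega)
         (frobenius (sym_gradient u x) `^ p)%:E +
       kappa_bd%:E * \int[surface_measure N]_(x in boundary Omega)
         (frobenius (u x) `^ p)%:E)%E].
Proof.
move=> N0 p1 oO bO; have p0 : 0 < p by lra.
have [M M0 hM] := pinfty_ex_gt0 bO.
have OM i y : Omega y -> `|y 0 i| <= M.
  by move=> Oy; exact: le_trans (rV_coord_le_norm y i) (hM y Oy).
have /choice[a ha] : forall i, exists a, exists b, _ := fun i =>
  exit_coordinate p1 oO (OM i) (ltW M0).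
have /choice[b hb] := ha.
have NR : 0 < N%:R :> R by rewrite ltr0n.
have Np : 0 < N%:R `^ (p - 1) :> R by exact: powR_gt0.
have sum_gt0 (c : 'I_N -> R) : (forall i, 0 < c i) -> 0 < \sum_i c i.
  move=> c0; rewrite (bigD1 (Ordinal N0))//= ltr_pwDl// sumr_ge0// => i _.
  exact: ltW.
have a0 : 0 < \sum_i a i by apply: sum_gt0 => i; have [] := hb i.
have b0 : 0 < \sum_i b i by apply: sum_gt0 => i; have [] := hb i.
pose ka := N%:R `^ (p - 1) * \sum_i a i.
pose kb := N%:R `^ (p - 1) * \sum_i b i.
have ka0 : 0 < ka by exact: mulr_gt0.
exists (ka `^ p^-1), kb; split; [by rewrite powR_gt0|exact: mulr_gt0|].
move=> u [su cu gu].
rewrite -powRrM mulVf ?gt_eqF// powRr1; last exact: ltW.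
have mO : measurable Omega by exact: open_measurable_rV.
have mp i j : measurable_fun Omega (partial i (fun y => u y 0 j)).
  by apply: continuous_open_measurable_rV => // x Ox; exact: (su j [:: i] x Ox).1.
have mu j : measurable_fun Omega (fun x => u x 0 j).
  by apply: continuous_open_measurable_rV => // x Ox; exact: (su j [::] x Ox).1.
have mS j : measurable_fun
    (boundary Omega : set (caratheodory_space (@hausdorff_outer R N N.-1)))
    (fun x => u x 0 j).
  apply: within_continuous_hausdorff_measurable (within_continuous_coord cu) _.
  - exact: closed_closure.
  - exact: boundary_closed.
  - by move=> x [].
have mbd : measurable
    (boundary Omega : set (caratheodory_space (@hausdorff_outer R N N.-1))).
  by apply: hausdorff_closed_measurable; exact: boundary_closed.
set E := (\int[lebesgue_rV N]_(x in Omega) (frobenius (sym_gradient u x) `^ p)%:E)%E.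
set B := (\int[surface_measure N]_(x in boundary Omega) _)%E.
have E0 : (0 <= E)%E by apply: integral_ge0 => x _; rewrite lee_fin powR_ge0.
have B0 : (0 <= B)%E by apply: integral_ge0 => x _; rewrite lee_fin powR_ge0.
have comp i : (\int[lebesgue_rV N]_(x in Omega) (`|u x 0 i| `^ p)%:E <=
    (a i)%:E * E + (b i)%:E * B)%E.
  have [ai bi hi] := hb i.
  have [g cg gE] := gu [:: i] i.
  have df y : Omega y -> derivable (fun x => u x 0 i) y (delta_mx 0 i).
    by move=> Oy; exact: (su i [::] y Oy).2.
  apply: (le_trans (hi (fun x => u x 0 i) g df (mp i i)
    (within_continuous_coord cu) cg gE)).
  apply: leeD.
    apply: lee_pmul; [by rewrite lee_fin ltW|exact: integral_ge0|exact: lexx|].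
    apply: (ge0_le_integral _ mO).
    - by move=> x _; rewrite lee_fin powR_ge0.
    - exact: measurable_abs_powR.
    - by apply/measurable_EFinP; exact: measurable_sym_gradient.
    - move=> x Ox; rewrite lee_fin; apply: ler_powR_base => //; first exact: ltW.
      by rewrite -sym_gradient_diag; exact: abs_le_frobenius.
  apply: lee_pmul; [by rewrite lee_fin ltW|exact: integral_ge0|exact: lexx|].
  apply: (ge0_le_integral _ mbd).
  - by move=> x _; rewrite lee_fin powR_ge0.
  - exact: measurable_abs_powR.
  - apply/measurable_EFinP; apply: (measurableT_comp (@measurable_powR R p)).
    by apply: measurable_frobenius => j k; rewrite ord1.
  - move=> x Ox; rewrite lee_fin; apply: ler_powR_base => //; first exact: ltW.
    exact: abs_le_frobenius.
apply: (le_trans (integral_frobenius_le p1 N0 mO mu)).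
apply: (@le_trans _ _ ((N%:R `^ (p - 1))%:E *
    \sum_(i < N) ((a i)%:E * E + (b i)%:E * B))%E).
  apply: lee_pmul; [exact: ltW|by apply: sume_ge0 => i _; exact: integral_ge0|exact: lexx|].
  by apply: lee_sum.
have ai0 i : (0 <= (a i)%:E)%E by rewrite lee_fin ltW//; have [] := hb i.
have bi0 i : (0 <= (b i)%:E)%E by rewrite lee_fin ltW//; have [] := hb i.
rewrite big_split/= -!ge0_sume_distrl// !sumEFin.
rewrite ge0_muleDr; first by rewrite !muleA -!EFinM.
  by rewrite mule_ge0// lee_fin ltW.
by rewrite mule_ge0// lee_fin ltW.
Qed.

Theorem theorem1 (R : realType) (N : nat) (p : R) (N_ge1 : (1 <= N)%N)
    (p_ge1 : 1 <= p) :
  (* (i) *)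
  (exists C : R, 0 < C /\
    forall Omega : set 'rV[R]_N, open Omega ->
    forall u : 'rV[R]_N -> 'rV[R]_N, smooth_compactly_supported Omega u ->
      (\int[lebesgue_rV N]_(x in Omega) (frobenius (u x) `^ p)%:E <=
       (C `^ p)%:E * \int[lebesgue_rV N]_(x in Omega)
         (frobenius x `^ p * frobenius (sym_gradient u x) `^ p)%:E)%E)
  /\
  (* (i), bounded Omega *)
  (forall Omega : set 'rV[R]_N, open Omega -> bounded_set Omega ->
    exists kappa : R, 0 < kappa /\
    forall u : 'rV[R]_N -> 'rV[R]_N, smooth_compactly_supported Omega u ->
      (\int[lebesgue_rV N]_(x in Omega) (frobenius (u x) `^ p)%:E <=
       (kappa `^ p)%:E * \int[lebesgue_rV N]_(x in Omega)
         (frobenius (sym_gradient u x) `^ p)%:E)%E)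
  /\
  (* (ii) *)
  (forall Omega : set 'rV[R]_N, bounded_lipschitz_domain Omega ->
    exists kappa kappa_bd : R, [/\ 0 < kappa, 0 < kappa_bd &
    forall u : 'rV[R]_N -> 'rV[R]_N, smooth_up_to_boundary Omega u ->
      (\int[lebesgue_rV N]_(x in Omega) (frobenius (u x) `^ p)%:E <=
       (kappa `^ p)%:E * \int[lebesgue_rV N]_(x in Omega)
         (frobenius (sym_gradient u x) `^ p)%:E +
       kappa_bd%:E * \int[surface_measure N]_(x in boundary Omega)
         (frobenius (u x) `^ p)%:E)%E]).
Proof.
split; first exact: hardy_sym_gradient.
split; first exact: korn_compact_support.
by move=> Omega [oO bO _]; exact: korn_trace.
Qed.
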